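(* Let $T$ be a complete monadically NIP theory with monster model $\mathfrak{C}$. Suppose $B,C$ are small subsets of $\mathfrak{C}$, $\bar a=(a_1,\dots,a_n)$ is a finite tuple from $\mathfrak{C}$, and $c$ is any singleton (a single element). 1. $\mathrm{tp}(\bar a/BC)$ does not fork over $B$ if and only if $\mathrm{tp}(a_i/BC)$ does not fork over $B$ for each $a_i\in\bar a$. 2. Suppose $\mathrm{tp}(\bar a/BC)$ does not fork over $B$. Then either $\mathrm{tp}(\bar a c/BC)$ does not fork over $B$, or $\mathrm{tp}(\bar a/BCc)$ does not fork over $B$. 3. For any small set $B$ and singletons $a,b,c$: if $\mathrm{tp}(a/Bb)$ forks over $B$ and $\mathrm{tp}(b/Bc)$ forks over $B$, then $\mathrm{tp}(a/Bc)$ forks over $B$.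
   Context: $\mathfrak{C}$ is a monster model (sufficiently saturated and strongly homogeneous) of $T$; ''small'' means of size less than the degree of saturation of $\mathfrak{C}$. $T$ is monadically NIP if the theory of the expansion of any model of $T$ by any number of unary predicates is NIP. Forking is the usual notion: a formula forks over $B$ if it implies a finite disjunction of formulas each dividing over $B$; a type forks over $B$ if it implies a formula that forks over $B$. Juxtaposition denotes union/concatenation. *)

(* Defs.v *)
From mathcomp Require Import all_boot.
From mathcomp Require Import boolp classical_sets functions cardinality.

Set Implicit Arguments.
Unset Strict Implicit.
Unset Printing Implicit Defensive.

Local Open Scope classical_set_scope.
Local Open Scope card_scope.

(** First-order logic with equality, one-sorted.  A finite tuple of length [n]
    from [M] is a function ['I_n -> M]. *)

Record language := Language {
  Fun : Type;
  farity : Fun -> nat;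
  Rel : Type;
  rarity : Rel -> nat }.

(** [term L n] and [formula L n]: variables are among [n] free ones;
    a quantifier binds the last variable of its body. *)
Inductive term (L : language) (n : nat) : Type :=
| Var of 'I_n
| App (f : Fun L) of ('I_(farity f) -> term L n).

Inductive formula (L : language) : nat -> Type :=
| Bot n : formula L n
| Equal n of term L n & term L n : formula L n
| Atom n (r : Rel L) of ('I_(rarity r) -> term L n) : formula L n
| Imp n of formula L n & formula L n : formula L n
| All n of formula L (n + 1) : formula L n.

Arguments Bot {L n}.
Arguments Atom {L n} r _.

Definition sentence (L : language) := formula L 0.

Definition Neg (L : language) n (f : formula L n) : formula L n := Imp f Bot.

Record structure (L : language) := Structure {
  dom :> Type;
  dom_inhabited : inhabited dom;
  fint : forall f : Fun L, ('I_(farity f) -> dom) -> dom;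
  rint : forall r : Rel L, ('I_(rarity r) -> dom) -> Prop }.

Definition tcat (T : Type) n m (a : 'I_n -> T) (b : 'I_m -> T) : 'I_(n + m) -> T :=
  fun k => match fintype.split k with inl i => a i | inr j => b j end.

Definition tsingle (T : Type) (x : T) : 'I_1 -> T := fun=> x.

Definition no_var (T : Type) (i : 'I_0) : T :=
  False_rect T (notF (ltn_ord i)).

Section Semantics.
Variables (L : language) (M : structure L).

Fixpoint eval n (v : 'I_n -> M) (t : term L n) : M :=
  match t with
  | Var i => v i
  | App f ts => fint (fun j => eval v (ts j))
  end.

Fixpoint sat n (f : formula L n) : ('I_n -> M) -> Prop :=
  match f in formula _ k return ('I_k -> M) -> Prop with
  | Bot _ => fun=> False
  | Equal _ t u => fun v => eval v t = eval v u
  | Atom _ r ts => fun v => rint (fun j => eval v (ts j))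
  | Imp _ f g => fun v => sat f v -> sat g v
  | All _ f => fun v => forall x : M, sat f (tcat v (tsingle x))
  end.

Definition holds (s : sentence L) : Prop := sat s (@no_var M).

Definition Th : set (sentence L) := [set s | holds s].

End Semantics.

Section Theories.
Variable L : language.

Definition theory := set (sentence L).

Definition models (M : structure L) (T : theory) : Prop :=
  forall s, T s -> holds M s.

Definition entails (T : theory) (s : sentence L) : Prop :=
  forall M : structure L, models M T -> holds M s.

Definition complete_theory (T : theory) : Prop :=
  (exists M : structure L, models M T) /\
  forall s, entails T s \/ entails T (Neg s).

(** A formula in [n + m] variables is read as a partitioned formula
    [f(x; y)] with [x] of length [n] and [y] of length [m]. *)
Definition has_IP (T : theory) n m (f : formula L (n + m)) : Prop :=
  forall N : nat, exists M : structure L, models M T /\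
    exists (a : 'I_N -> 'I_n -> M) (b : {set 'I_N} -> 'I_m -> M),
      forall i s, sat f (tcat (a i) (b s)) <-> i \in s.

Definition NIP (T : theory) : Prop :=
  forall n m (f : formula L (n + m)), ~ has_IP T f.

End Theories.

Definition unary_expansion_language (L : language) (I : Type) : language :=
  @Language (Fun L) (@farity L) (Rel L + I)
    (fun r => match r with inl r => rarity r | inr _ => 1 end).

Definition unary_expansion (L : language) (M : structure L) (I : Type)
    (P : I -> set M) : structure (unary_expansion_language L I) :=
  @Structure (unary_expansion_language L I) M (dom_inhabited M)
    (fun f => @fint L M f)
    (fun r => match r return
       ('I_(@rarity (unary_expansion_language L I) r) -> M) -> Prop with
     | inl r => fun v => @rint L M r v
     | inr i => fun v => P i (v (@ord0 0))
     end).

Definition monadically_NIP (L : language) (T : theory L) : Prop :=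
  forall M : structure L, models M T ->
  forall (I : Type) (P : I -> set M), NIP (Th (unary_expansion P)).

Section Monster.
Variables (L : language) (M : structure L).

(** Formulas [f(x, b)] with [x] of length [n] and a finite tuple [b] of
    parameters from [M]. *)
Record pformula (n : nat) := PFormula {
  plen : nat;
  pform : formula L (n + plen);
  ppar : 'I_plen -> M }.
Arguments ppar {n} p _.

Definition psat n (p : pformula n) (a : 'I_n -> M) : Prop :=
  sat (pform p) (tcat a (ppar p)).

Definition over n (A : set M) (p : pformula n) : Prop :=
  forall j, A (ppar p j).

Definition tp n (a : 'I_n -> M) (A : set M) : set (pformula n) :=
  [set p | over A p /\ psat p a].

Definition finitely_satisfiable n (S : set (pformula n)) : Prop :=
  forall N (q : 'I_N -> pformula n), (forall i, S (q i)) ->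
    exists a : 'I_n -> M, forall i, psat (q i) a.

(** Cardinals are represented by types [K]; [small K A] means [|A| < |K|]. *)
Definition small (K T : Type) (A : set T) : Prop :=
  A #<= [set: K] /\ ~ ([set: K] #<= A).

Definition saturated (K : Type) : Prop :=
  forall (A : set M), small K A ->
  forall n (S : set (pformula n)), S `<=` over A -> finitely_satisfiable S ->
    exists a : 'I_n -> M, forall p, S p -> psat p a.

Definition partial_elementary (A : set M) (h : M -> M) : Prop :=
  forall n (f : formula L n) (v : 'I_n -> M), (forall i, A (v i)) ->
    sat f v <-> sat f (h \o v).

Definition automorphism (h : M -> M) : Prop :=
  [/\ bijective h,
      forall (f : Fun L) (v : 'I_(farity f) -> M), h (fint v) = fint (h \o v)
    & forall (r : Rel L) (v : 'I_(rarity r) -> M), rint v <-> rint (h \o v)].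

Definition strongly_homogeneous (K : Type) : Prop :=
  forall (A : set M) (h : M -> M), small K A -> partial_elementary A h ->
    exists2 g : M -> M, automorphism g & forall x, A x -> g x = h x.

(** [f(x, b)] divides over [B] if for some [k] and some sequence of
    realizations [b_i] of [tp(b/B)], the set of all [f(x, b_i)] is
    [k]-inconsistent. *)
Definition divides n (B : set M) (p : pformula n) : Prop :=
  exists (k : nat) (b : nat -> 'I_(plen p) -> M),
    (forall i, tp (b i) B = tp (ppar p) B) /\
    forall s : 'I_k -> nat, injective s ->
      ~ exists a : 'I_n -> M, forall i, sat (pform p) (tcat a (b (s i))).

Definition formula_forks n (B : set M) (p : pformula n) : Prop :=
  exists (N : nat) (q : 'I_N -> pformula n),
    (forall i, divides B (q i)) /\
    forall a, psat p a -> exists i, psat (q i) a.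

(** Implication is evaluated in [M]; for sets of formulas over a small set of
    parameters this is the usual one, by saturation. *)
Definition type_implies n (S : set (pformula n)) (p : pformula n) : Prop :=
  forall a : 'I_n -> M, (forall q, S q -> psat q a) -> psat p a.

Definition forks n (B : set M) (S : set (pformula n)) : Prop :=
  exists2 p : pformula n, type_implies S p & formula_forks B p.

End Monster.

Arguments ppar {L M n} p _.

(** [M] is a monster model of [T] with degree of saturation [|K|]: it is
    [|K|]-saturated and strongly [|K|]-homogeneous, where [|K|] exceeds the
    (always infinite) number of [L]-formulas. *)
Definition monster (L : language) (T : theory L) (M : structure L) (K : Type)
    : Prop :=
  [/\ models M T, small K [set: {n : nat & formula L n}],
      saturated M K & strongly_homogeneous M K].

(* Main.v *)
(** Part (1) follows from (2) by induction on the tuple and left transitivity of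
    nonforking; under NIP the latter holds because an indiscernible sequence stays
    indiscernible over a tuple that does not fork with it.  Part (3) is (2) for
    [C = {c}].

    If both alternatives of (2) fail, one finds [phi(b, c; a)] dividing over [B]
    and [psi(x; a, c)], true of [b], forking over [B], where [b] does not fork over
    [B] with an indiscernible sequence [(a_t)] that witnesses the dividing of
    [phi].  Choose [b_s] nonforking over everything chosen before, then [c_{s,t}]
    with [(b_s, c_{s,t}, a_t)] of the same type over [B] as [(b, c, a)].  The
    formula [phi /\ psi] holds at [(b_s, c_{s,t}, a_t)]; it fails at
    [(b_s', c_{s,t}, a_t)] for [s' > s], because [psi] forks, and at
    [(b_s, c_{s,t}, a_v)] for all but finitely many [v], because [phi] divides.
    After an application of Ramsey's theorem this makes the pair [(s, t)] definable
    from the single element [c_{s,t}], so a unary predicate on these elements codes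
    an arbitrary relation on pairs and the expansion has IP. *)

Require Import Defs.
From mathcomp Require Import all_boot.
From mathcomp Require Import boolp classical_sets functions cardinality filter.
From mathcomp Require Import zify.

Set Implicit Arguments.
Unset Strict Implicit.
Unset Printing Implicit Defensive.

Local Open Scope classical_set_scope.

(** * Cardinals *)

Section Cardinals.
Local Open Scope card_scope.

Lemma card_le_of_fun T U (A : set T) (B : set U) (f : T -> U) :
  (forall x, A x -> B (f x)) ->
  (forall x y, A x -> A y -> f x = f y -> x = y) -> A #<= B.
Proof.
move=> fAB finj.
have : $|{injfun A >-> B}|.
  apply/injfunPex; exists f => // x y /set_mem Ax /set_mem Ay; exact: finj.
by case=> g; exact: inj_card_le.
Qed.

Lemma card_le_fun T U (A : set T) (B : set U) (u0 : U) : A #<= B ->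
  exists f : T -> U, (forall x, A x -> B (f x)) /\
    forall x y, A x -> A y -> f x = f y -> x = y.
Proof.
move=> /card_leP[f].
pose g x := match pselect (A x) with
  | left Ax => val (f (SigSub (mem_set Ax))) | right _ => u0 end.
exists g; split=> [x Ax|x y Ax Ay].
  by rewrite /g; case: pselect => // ?; apply/set_mem/valP.
rewrite /g; case: pselect => // Ax'; case: pselect => // Ay' /val_inj.
by move=> /(@inj _ _ _ f); rewrite !inE => /(_ I I) /(congr1 val).
Qed.

(** Zorn's lemma applies to the graphs of partial injections from [A] to [B]; a maximal graph is
    defined on all of [A] or reaches all of [B]. *)
Lemma card_le_total T U (A : set T) (B : set U) : A #<= B \/ B #<= A.
Proof.
have [->|/set0P[a0 Aa0]] := eqVneq A set0; first by left.
have [->|/set0P[b0 Bb0]] := eqVneq B set0; first by right.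
pose P (G : set (T * U)) :=
  [/\ forall x y, G (x, y) -> A x /\ B y,
      forall x y y', G (x, y) -> G (x, y') -> y = y' &
      forall x x' y, G (x, y) -> G (x', y) -> x = x'].
have [|G [[GAB Gf Gi] Gmax]] := @Zorn_bigcup _ P.
  move=> F FP Ftot; split.
  - by move=> x y [G FG Gxy]; have [GAB _ _] := FP _ FG; exact: GAB.
  - move=> x y y' [G FG Gxy] [H FH Hxy].
    by have [GH|HG] := Ftot _ _ FG FH; [have [_ Hf _] := FP _ FH|have [_ Hf _] := FP _ FG];
      apply: Hf; eauto.
  - move=> x x' y [G FG Gxy] [H FH Hxy].
    by have [GH|HG] := Ftot _ _ FG FH; [have [_ _ Hf] := FP _ FH|have [_ _ Hf] := FP _ FG];
      apply: Hf; eauto.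
have [domG|/existsNP[x0 /not_implyP[Ax Gx]]] := pselect (forall x, A x -> exists y, G (x, y)).
  left; have /choice[f fP] : forall x, exists y, A x -> G (x, y).
    move=> x; have [/domG[y Gxy]|nA] := pselect (A x); first by exists y.
    by exists b0.
  apply: (@card_le_of_fun _ _ _ _ f) => [x Ax|x y Ax Ay fxy].
    by have [] := GAB _ _ (fP _ Ax).
  by apply: (Gi _ _ (f x)); [exact: fP|rewrite fxy; exact: fP].
have [ranG|/existsNP[y0 /not_implyP[By Gy]]] := pselect (forall y, B y -> exists x, G (x, y)).
  right; have /choice[f fP] : forall y, exists x, B y -> G (x, y).
    move=> y; have [/ranG[u Gxy]|nA] := pselect (B y); first by exists u.
    by exists a0.
  apply: (@card_le_of_fun _ _ _ _ f) => [y By|y y' By By' fxy].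
    by have [] := GAB _ _ (fP _ By).
  by apply: (Gf (f y)); [exact: fP|rewrite fxy; exact: fP].
(* A point outside the domain paired with a point outside the range would enlarge the maximal
   graph. *)
exfalso; apply: (Gmax (G `|` [set (x0, y0)])).
  split=> [|/(_ (x0, y0)) H]; first by move=> ? ?; left.
  by apply: Gx; exists y0; apply: H; right.
split.
- by move=> ? ? [/GAB//|[-> ->]].
- move=> u v v' [Guv|[-> ->]] [Guv'|[]]; first exact: Gf Guv Guv'.
  + by move=> eu _; case: Gx; exists v; rewrite -eu.
  + by case: Gx; exists v'.
  + by move=> ->.
- move=> u u' v [Guv|[-> ->]] [Guv'|[]]; first exact: Gi Guv Guv'.
  + by move=> _ ev; case: Gy; exists u; rewrite -ev.
  + by case: Gy; exists u'.
  + by move=> ->.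
Qed.

(* A maximal family of disjoint injective sequences in [A] misses only
   finitely many points. *)
Lemma card_le_setX_bool T (A : set T) :
  infinite_set A -> A `*` [set: bool] #<= A.
Proof.
move=> Ainf.
have seqE (B : set T) : infinite_set B -> exists f : nat -> T,
    (forall n, B (f n)) /\ injective f.
  move=> Binf; have [b0 _] := infinite_setN0 Binf.
  have /(card_le_fun b0)[f [fB finj]] := (infiniteP B).1 Binf.
  by exists f; split=> [n|m n]; [exact: fB|exact: finj].
pose P (F : set (nat -> T)) :=
  (forall f, F f -> (forall n, A (f n)) /\ injective f) /\
  forall f g m n, F f -> F g -> f m = g n -> f = g.
have [|F [[FA Fd] Fmax]] := @Zorn_bigcup _ P.
  move=> FF FP Ftot; split=> [f [G FG Gf]|f g m n [G FG Gf] [H FH Hg]].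
    by have [GA _] := FP _ FG; exact: GA.
  have [GH|HG] := Ftot _ _ FG FH.
    by have [_ Hd] := FP _ FH; apply: Hd => //; exact: GH.
  by have [_ Gd] := FP _ FG; apply: Gd => //; exact: HG.
pose S : set T := [set x | exists f n, F f /\ x = f n].
have Rfin : finite_set (A `\` S).
  apply: contrapT => /seqE[f [fR finj]].
  have nFf : ~ F f by move=> Ff; have [_] := fR 0; case; exists f, 0.
  apply: (Fmax (F `|` [set f])).
    by split=> [|/(_ f) H]; [move=> ? ?; left|apply/nFf/H; right].
  split=> [g [/FA|->]|g h m n [Fg|->] [Fh|->]] //.
  - by split=> // n; have [] := fR n.
  - exact: Fd.
  - by move=> gf; have [_] := fR n; case; exists g, m.
  - by move=> gf; have [_] := fR m; case; exists h, n.
have [f0 Ff0] : exists f, F f.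
  apply: contrapT => nF; apply: Ainf; apply: sub_finite_set Rfin => x Ax.
  by split=> // -[f [n [Ff _]]]; apply: nF; exists f.
have [a0 _] := infinite_setN0 Ainf.
have [i [_ iinj]] := card_le_fun 0 (finite_set_countable Rfin).
have /choice[p pP] : forall x, exists p : (nat -> T) * nat, S x -> F p.1 /\ x = p.1 p.2.
  move=> x; have [[f [n [Ff ->]]]|nS] := pselect (S x); first by exists (f, n).
  by exists (f0, 0).
(* A point on a sequence of the family stays on that sequence; the finitely many other points go
   onto [f0]. The last bit of the code keeps the two cases apart. *)
pose h (xb : T * bool) := if pselect (S xb.1)
  then (p xb.1).1 (pickle ((p xb.1).2, xb.2, false))
  else f0 (pickle (i xb.1, xb.2, true)).
have pickle_inj : injective (@pickle (nat * bool * bool)%type) by exact: pcan_inj pickleK.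
apply: (@card_le_of_fun _ _ _ _ h).
  move=> [x b] [/= Ax _]; rewrite /h /=; case: pselect => [Sx|nSx].
    by have [/FA[pA _] _] := pP _ Sx; exact: pA.
  by have [fA _] := FA _ Ff0; exact: fA.
move=> [x b] [y c] [/= Ax _] [/= Ay _]; rewrite /h /=.
case: pselect => [Sx|nSx]; case: pselect => [Sy|nSy] /= e.
- have [Fx ex] := pP _ Sx; have [Fy ey] := pP _ Sy.
  have pxy := Fd _ _ _ _ Fx Fy e.
  have [_ pinj] := FA _ Fy; move: e; rewrite pxy => /pinj/pickle_inj[e2 ->].
  by rewrite ex ey pxy e2.
- have [Fx _] := pP _ Sx; have pxy := Fd _ _ _ _ Fx Ff0 e.
  by have [_ pinj] := FA _ Ff0; move: e; rewrite pxy => /pinj/pickle_inj[].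
- have [Fy _] := pP _ Sy; have pxy := Fd _ _ _ _ Ff0 Fy e.
  by have [_ pinj] := FA _ Ff0; move: e; rewrite -pxy => /pinj/pickle_inj[].
- have [_ pinj] := FA _ Ff0; move: e => /pinj/pickle_inj[e ->].
  by rewrite (iinj x y).
Qed.

Lemma small_sub K T (A B : set T) : A `<=` B -> small K B -> small K A.
Proof.
move=> AB [BK nKB]; split; first exact: card_le_trans (subset_card_le AB) BK.
by move=> KA; apply/nKB/(card_le_trans KA)/subset_card_le.
Qed.

(** The upper bound is the absorption of two copies of [K] by [K]. For strictness, an injection of
    [K] into the union splits [K] into two preimages, and the larger one has the size of [K]. *)
Lemma small_setU K T (A B : set T) : infinite_set [set: K] ->
  small K A -> small K B -> small K (A `|` B).
Proof.
move=> Kinf [AK nKA] [BK nKB].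
have [k0 _] := infinite_setN0 Kinf.
have [fA [_ fAi]] := card_le_fun k0 AK.
have [fB [_ fBi]] := card_le_fun k0 BK.
have [d [_ di]] := card_le_fun k0 (card_le_setX_bool Kinf).
split.
  pose f x := if pselect (A x) then d (fA x, true) else d (fB x, false).
  apply: (@card_le_of_fun _ _ _ _ f) => // x y ABx ABy; rewrite /f.
  case: pselect => [Ax|nAx]; case: pselect => [Ay|nAy] /di => /(_ (conj I I) (conj I I)) [] //.
  - exact: fAi.
  - by case: ABx ABy => [//|Bx] [//|By]; exact: (fBi _ _ Bx By).
move=> KAB.
have [[t0]|nT] := pselect (inhabited T); last first.
  apply: nKA; apply: card_le_trans KAB _.
  by apply: subset_card_le => x; case: nT.
have [g [gAB gi]] := card_le_fun t0 KAB.
(* The preimage of [D] is infinite, so it contains two disjoint copies of itself: one for its own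
   points, one for those of the smaller preimage of [C]. *)
have half (C D : set T) : (forall k, C (g k) \/ D (g k)) ->
    [set k | C (g k)] #<= [set k | D (g k)] -> [set: K] #<= D.
  move=> CD CleD.
  have [h [hD hi]] := card_le_fun k0 CleD.
  have Dinf : infinite_set [set k | D (g k)].
    move=> Dfin; apply: Kinf;
      apply: (@sub_finite_set _ _ ([set k | C (g k)] `|` [set k | D (g k)])).
      by move=> k _; exact: CD.
    by rewrite finite_setU; split=> //; exact: card_le_finite CleD Dfin.
  have [e [eD ei]] := card_le_fun k0 (card_le_setX_bool Dinf).
  pose f k := if pselect (D (g k)) then e (k, true) else e (h k, false).
  have fD k : D (g (f k)).
    rewrite /f; case: pselect => [Dk|nDk]; first exact: (eD (k, true)).
    by apply: (eD (h k, false)); split=> //; apply: hD; case: (CD k).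
  have ei' k l b c : D (g k) -> D (g l) -> e (k, b) = e (l, c) -> (k, b) = (l, c).
    by move=> Dk Dl; apply: ei.
  have fi : injective f.
    move=> k l; rewrite /f; case: pselect => [Dk|nDk]; case: pselect => [Dl|nDl] /=.
    - by move=> /ei' H; have [] := H Dk Dl.
    - have /hD hl : C (g l) by case: (CD l).
      by move=> /ei' H; have [] := H Dk hl.
    - have /hD hk : C (g k) by case: (CD k).
      by move=> /ei' H; have [] := H hk Dl.
    - have Ck : C (g k) by case: (CD k).
      have Cl : C (g l) by case: (CD l).
      by move=> /ei' H; have [/hi] := H (hD _ Ck) (hD _ Cl); apply.
  apply: (@card_le_of_fun _ _ _ _ (g \o f)) => [k _|k l _ _ /= e']; first exact: fD.
  exact/fi/(gi _ _ I I e').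
have gC k : A (g k) \/ B (g k) by exact: gAB.
have [le|le] := card_le_total [set k | A (g k)] [set k | B (g k)].
  exact/nKB/(half A B).
by apply/nKA/(half B A) => // k; case: (gC k); [right|left].
Qed.

(** The formulas [Bot] in [n] variables are already infinitely many. *)
Lemma small_countable K T (A : set T) L : small K [set: {n : nat & formula L n}] ->
  countable A -> small K A.
Proof.
move=> [LK nKL] Acnt.
have AL : A #<= [set: {n : nat & formula L n}].
  apply: card_le_trans Acnt _; pose f n : {n : nat & formula L n} := existT _ n Bot.
  by apply: (@card_le_of_fun _ _ _ _ f) => // m n _ _ /(congr1 (@projT1 _ _)).
by split=> [|KA]; [exact: card_le_trans LK|exact/nKL/(card_le_trans KA)].
Qed.

Lemma small_infinite K L : small K [set: {n : nat & formula L n}] -> infinite_set [set: K].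
Proof.
move=> [LK _]; apply/infiniteP; apply: card_le_trans LK.
pose f n : {n : nat & formula L n} := existT _ n Bot.
by apply: (@card_le_of_fun _ _ _ _ f) => // m n _ _ /(congr1 (@projT1 _ _)).
Qed.

End Cardinals.

(** * Definable sets *)

Lemma tcatl T n m (a : 'I_n -> T) (b : 'I_m -> T) i : tcat a b (lshift m i) = a i.
Proof. by rewrite /tcat (unsplitK (inl i)). Qed.

Lemma tcatr T n m (a : 'I_n -> T) (b : 'I_m -> T) j : tcat a b (rshift n j) = b j.
Proof. by rewrite /tcat (unsplitK (inr j)). Qed.

Lemma tcat_comp T U n m (a : 'I_n -> T) (b : 'I_m -> T) (f : T -> U) :
  f \o tcat a b = tcat (f \o a) (f \o b).
Proof. by apply/funext => k; rewrite /tcat /=; case: fintype.split. Qed.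

Section Renaming.
Variable L : language.

Fixpoint term_ren n m (s : 'I_n -> 'I_m) (t : term L n) : term L m :=
  match t with
  | Var i => Var L (s i)
  | App f ts => App (fun j => term_ren s (ts j))
  end.

Definition lift_ren n m (s : 'I_n -> 'I_m) : 'I_(n + 1) -> 'I_(m + 1) :=
  tcat (lshift 1 \o s) (@rshift m 1).

Fixpoint ren n (f : formula L n) : forall m, ('I_n -> 'I_m) -> formula L m :=
  match f in formula _ k return forall m, ('I_k -> 'I_m) -> formula L m with
  | Bot _ => fun m _ => Bot
  | Equal _ t u => fun m s => Equal (term_ren s t) (term_ren s u)
  | Atom _ r ts => fun m s => Atom r (fun j => term_ren s (ts j))
  | Imp _ f g => fun m s => Imp (ren f s) (ren g s)
  | All _ f => fun m s => All (ren f (lift_ren s))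
  end.

Lemma eval_ren (M : structure L) n m (s : 'I_n -> 'I_m) (t : term L n) (v : 'I_m -> M) :
  eval v (term_ren s t) = eval (v \o s) t.
Proof. by elim: t => //= f ts IH; congr (fint _); apply/funext. Qed.

Lemma sat_ren (M : structure L) n (f : formula L n) m (s : 'I_n -> 'I_m) (v : 'I_m -> M) :
  sat (ren f s) v <-> sat f (v \o s).
Proof.
elim: f m s v => {n} /= [n|n t u|n r ts|n f IHf g IHg|n f IHf] m s v //=.
- by rewrite !eval_ren.
- rewrite (_ : (fun j => eval v _) = (fun j => eval (v \o s) (ts j))) //.
  by apply/funext => j; rewrite eval_ren.
- by rewrite IHf IHg.
- have E x : tcat v (tsingle x) \o lift_ren s = tcat (v \o s) (tsingle x).
    rewrite /lift_ren tcat_comp; congr tcat; apply/funext => i /=.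
      by rewrite tcatl.
    by rewrite tcatr.
  by split=> H x; have := H x; rewrite IHf E.
Qed.

End Renaming.

Section DefinableSets.
Variables (L : language) (M : structure L).

(* Variables range over an arbitrary index type [V], so that infinite tuples
   and concatenations (sum types) need no coding into ['I_n]. *)
Definition inst V (v : V -> M) (x : V + M) : M :=
  match x with inl i => v i | inr m => m end.

(** A property of predicates rather than formulas, so that most formulas are handled through closure
    properties. The map [r] sends each variable of [f] to a coordinate of [v] or to a parameter. *)
Definition definable (A : set M) V (X : (V -> M) -> Prop) : Prop :=
  exists n (f : formula L n) (r : 'I_n -> V + M),
    (forall k m, r k = inr m -> A m) /\ forall v, X v <-> sat f (inst v \o r).

Definition join V W (v : V -> M) (w : W -> M) (x : V + W) : M :=
  match x with inl i => v i | inr j => w j end.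

Lemma definable_ext A V (X Y : (V -> M) -> Prop) :
  (forall v, X v <-> Y v) -> definable A X -> definable A Y.
Proof.
move=> XY [n [f [r [rA Xf]]]]; exists n, f, r; split=> // v.
by rewrite -XY.
Qed.

Lemma definable_sub A B V (X : (V -> M) -> Prop) : A `<=` B -> definable A X -> definable B X.
Proof.
move=> AB [n [f [r [rA Xf]]]]; exists n, f, r; split=> // k m /rA.
exact: AB.
Qed.

Lemma definable_form A V n (f : formula L n) (r : 'I_n -> V + M) :
  (forall k m, r k = inr m -> A m) -> definable A (fun v => sat f (inst v \o r)).
Proof. by move=> rA; exists n, f, r. Qed.

Lemma definable_False A V : definable A (fun _ : V -> M => False).
Proof. by exists 0, Bot, (@no_var _); split=> // -[]. Qed.

Lemma definable_imp A V (X Y : (V -> M) -> Prop) :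
  definable A X -> definable A Y -> definable A (fun v => X v -> Y v).
Proof.
move=> [n [f [r [rA Xf]]]] [m [g [s [sA Yg]]]].
exists (n + m), (Imp (ren f (lshift m)) (ren g (@rshift n m))), (tcat r s); split.
  by move=> k x; rewrite /tcat; case: fintype.split => i; [exact: rA|exact: sA].
move=> v /=; rewrite Xf Yg !sat_ren.
suff [-> ->] : (inst v \o tcat r s) \o lshift m = inst v \o r /\
  (inst v \o tcat r s) \o @rshift n m = inst v \o s by [].
by split; apply/funext => k /=; rewrite (tcatl, tcatr).
Qed.

Lemma definable_neg A V (X : (V -> M) -> Prop) : definable A X -> definable A (fun v => ~ X v).
Proof. by move=> AX; apply: definable_imp => //; exact: definable_False. Qed.

Lemma definable_True A V : definable A (fun _ : V -> M => True).
Proof. by apply: definable_ext (definable_neg (definable_False A V)) => v; split=> // _ []. Qed.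

Lemma definable_and A V (X Y : (V -> M) -> Prop) :
  definable A X -> definable A Y -> definable A (fun v => X v /\ Y v).
Proof.
move=> AX AY; apply: definable_ext (definable_neg (definable_imp AX (definable_neg AY))) => v.
by split=> [/not_implyP[Xv /contrapT]|[Xv Yv] /(_ Xv)].
Qed.

Lemma definable_or A V (X Y : (V -> M) -> Prop) :
  definable A X -> definable A Y -> definable A (fun v => X v \/ Y v).
Proof.
move=> AX AY; apply: definable_ext (definable_imp (definable_neg AX) AY) => v.
by split=> [|[]] //; have [Xv _|nXv H] := pselect (X v); [left|right; exact: H].
Qed.

Lemma definable_subst A V W (X : (V -> M) -> Prop) (s : V -> W + M) :
  (forall x m, s x = inr m -> A m) -> definable A X ->
  definable A (fun w => X (inst w \o s)).
Proof.
move=> sA [n [f [r [rA Xf]]]].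
exists n, f, (fun k => match r k with inl x => s x | inr m => inr m end); split.
  by move=> k m; case E: (r k) => [x|m'] => [/sA|[<-]] //; exact: rA E.
move=> w; rewrite Xf; set g := (X in sat f X <-> _); set h := (X in _ <-> sat f X).
by have -> : g = h by apply/funext => k; rewrite /g /h /=; case: (r k).
Qed.

Lemma definable_comp A V W (X : (V -> M) -> Prop) (s : V -> W) :
  definable A X -> definable A (fun w => X (w \o s)).
Proof.
move=> AX; apply: definable_ext (@definable_subst A V W X (fun x => inl (s x)) _ AX) => //.
Qed.

Lemma definable_plug A V W (X : (V + W -> M) -> Prop) (w : W -> M) :
  (forall j, A (w j)) -> definable A X -> definable A (fun v => X (join v w)).
Proof.
move=> wA AX.
pose s (x : V + W) : V + M := match x with inl i => inl i | inr j => inr (w j) end.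
apply: definable_ext (@definable_subst A _ V X s _ AX) => [v|[i|j] m //= [<-] //].
suff -> : inst v \o s = join v w by [].
by apply/funext => -[].
Qed.

(** This brings an assignment of variables into partitioned form: [rho] has one entry for each
    position that [r] sends outside ['I_n]. *)
Lemma split_vars n0 n S (r : 'I_n0 -> 'I_n + S) :
  exists m (rho : 'I_m -> S) (s : 'I_n0 -> 'I_(n + m)),
    (forall j, exists k, r k = inr (rho j)) /\
    forall k, tcat inl (inr \o rho) (s k) = r k.
Proof.
pose Q := [pred k | if r k is inr _ then true else false].
have /choice[rho rhoP] : forall j : 'I_#|Q|, exists y, r (enum_val j) = inr y.
  move=> j; have := enum_valP j; rewrite inE /Q /=.
  by case: (r _) => // y _; exists y.
have /choice[s sP] : forall k, exists j : 'I_(n + #|Q|), tcat inl (inr \o rho) j = r k.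
  move=> k; case E: (r k) => [i|y]; first by exists (lshift _ i); rewrite tcatl.
  have Qk : k \in Q by rewrite inE /= E.
  exists (rshift n (enum_rank_in Qk k)); rewrite tcatr /= -rhoP.
  by rewrite enum_rankK_in.
by exists #|Q|, rho, s; split=> // j; exists (enum_val j).
Qed.

Lemma definable_split A n V (X : ('I_n + V -> M) -> Prop) : definable A X ->
  exists m (g : formula L (n + m)) (rho : 'I_m -> V + M),
    (forall j x, rho j = inr x -> A x) /\
    forall u v, X (join u v) <-> sat g (tcat u (inst v \o rho)).
Proof.
move=> [n0 [f [r [rA Xf]]]].
pose r' k : 'I_n + (V + M) := match r k with
  | inl (inl i) => inl i | inl (inr j) => inr (inl j) | inr x => inr (inr x) end.
have [m [rho [s [rhoP sP]]]] := split_vars r'.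
exists m, (ren f s), rho; split.
  move=> j x E; have [k] := rhoP j; rewrite E /r' => H; apply: (rA k).
  by move: H; case: (r k) => [[i|i] //|y [->]].
move=> u v; rewrite Xf sat_ren.
suff -> : inst (join u v) \o r = tcat u (inst v \o rho) \o s by [].
apply/funext => k /=.
have -> : tcat u (inst v \o rho) (s k) = join u (inst v) (r' k).
  rewrite -sP -[RHS]/((join u (inst v) \o tcat inl (inr \o rho)) (s k)) tcat_comp.
  by congr tcat.
by rewrite /r'; case: (r k) => [[]|].
Qed.

Lemma definable_all1 A V (X : ('I_1 + V -> M) -> Prop) :
  definable A X -> definable A (fun v => forall x : M, X (join (tsingle x) v)).
Proof.
move=> /definable_split[m [g [rho [rhoA Xg]]]].
(* [All] binds the last variable while the quantified one comes first in [X]; the renaming swaps the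
   two blocks. *)
exists m, (All (ren g (tcat (@rshift m 1) (lshift 1)))), rho; split=> // v /=.
suff E x : tcat (inst v \o rho) (tsingle x) \o tcat (@rshift m 1) (lshift 1) =
    tcat (tsingle x) (inst v \o rho).
  by split=> H x; have := H x; rewrite sat_ren E Xg.
rewrite tcat_comp; congr tcat; apply/funext => i /=; first by rewrite tcatr.
by rewrite tcatl.
Qed.

Lemma definable_all A V n (X : ('I_n + V -> M) -> Prop) :
  definable A X -> definable A (fun v => forall u : 'I_n -> M, X (join u v)).
Proof.
elim: n V X => [|n IH] V X AX.
  pose s (x : 'I_0 + V) : V := match x with inl i => no_var V i | inr j => j end.
  apply: definable_ext (definable_comp s AX) => v.
  have E u : v \o s = join u v by apply/funext => -[[]|].
  by split=> [H u|/(_ (@no_var M))]; rewrite -E.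
pose s (x : 'I_n.+1 + V) : 'I_n + ('I_1 + V) := match x with
  | inl i => if unlift ord0 i is Some j then inl j else inr (inl ord0)
  | inr j => inr (inr j) end.
have := definable_all1 (IH _ _ (definable_comp s AX)).
apply: definable_ext => v; split=> [H u|H x u].
  have := H (u ord0) (u \o lift ord0).
  suff -> : join (u \o lift ord0) (join (tsingle (u ord0)) v) \o s = join u v by [].
  by apply/funext => -[i|j] //=; case: unliftP => [j ->|->].
set w := _ \o s; have := H (w \o inl).
suff -> : join (w \o inl) v = w by [].
by apply/funext => -[].
Qed.

Lemma definable_ex A V n (X : ('I_n + V -> M) -> Prop) :
  definable A X -> definable A (fun v => exists u : 'I_n -> M, X (join u v)).
Proof.
move=> AX; apply: definable_ext (definable_neg (definable_all (definable_neg AX))) => v.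
by rewrite -existsNP; split=> -[u]; [move/contrapT|]; exists u => //; exact.
Qed.

Lemma definable_forall_ord A V N (X : 'I_N -> (V -> M) -> Prop) :
  (forall i, definable A (X i)) -> definable A (fun v => forall i, X i v).
Proof.
elim: N X => [|N IH] X AX.
  by apply: definable_ext (definable_True A V) => v; split=> // _ [].
apply: definable_ext (definable_and (AX ord0) (IH _ (fun i => AX (lift ord0 i)))) => v.
split=> [[X0 XS] i|H]; first by case: (unliftP ord0 i) => [j|] ->.
by split.
Qed.

(** A formula has finitely many variables, so it sees only finitely many terms of an infinite
    sequence of tuples. *)
Lemma definable_support A V J (X : (V + nat * J -> M) -> Prop) : definable A X ->
  exists N, forall x v w, (forall i j, i < N -> v (i, j) = w (i, j)) ->
    X (join x v) <-> X (join x w).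
Proof.
move=> [n [f [r [rA Xf]]]].
pose b k := if r k is inl (inr (i, _)) then i.+1 else 0.
exists (\max_k b k) => x v w vw; rewrite !Xf.
suff -> : inst (join x v) \o r = inst (join x w) \o r by [].
apply/funext => k /=; have := @leq_bigmax _ b k; rewrite /b.
by case: (r k) => [[//|[i j]]|//] /=; exact: vw.
Qed.

(** In the dichotomy this lets the parameters of the forking formula become part of the tuple that
    starts the indiscernible sequence. *)
Lemma definable_params A V (X : (V -> M) -> Prop) : definable A X ->
  exists l (d : 'I_l -> M) (Y : (V + 'I_l -> M) -> Prop),
    [/\ forall j, A (d j), definable set0 Y & forall v, X v <-> Y (join v d)].
Proof.
move=> [n0 [f [r [rA Xf]]]].
pose r' k : 'I_0 + (V + M) := inr (r k).
pose Q := [pred k | if r k is inr _ then true else false].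
have /choice[d dP] : forall j : 'I_#|Q|, exists y, r (enum_val j) = inr y.
  move=> j; have := enum_valP j; rewrite inE /Q /=.
  by case: (r _) => // y _; exists y.
have /choice[s sP] : forall k, exists j : V + 'I_#|Q|, forall v, join v d j = inst v (r k).
  move=> k; case E: (r k) => [i|y]; first by exists (inl i).
  have Qk : k \in Q by rewrite inE /= E.
  exists (inr (enum_rank_in Qk k)) => v /=.
  by have := dP (enum_rank_in Qk k); rewrite enum_rankK_in // E => -[->].
exists #|Q|, d, (fun w => sat f (w \o s)); split.
- by move=> j; exact: rA (dP j).
- by exists n0, f, (fun k => inl (s k)); split.
- move=> v; rewrite Xf; suff -> : inst v \o r = join v d \o s by [].
  by apply/funext => k /=; rewrite sP.
Qed.

Lemma definable_range A V W (X : (V -> M) -> Prop) (e : W -> M) :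
  definable (A `|` range e) X ->
  exists Y : (V + W -> M) -> Prop, definable A Y /\ forall v, X v <-> Y (join v e).
Proof.
move=> [n [f [r [rA Xf]]]].
have /choice[s sP] : forall k, exists j : (V + W) + M,
    (forall m, j = inr m -> A m) /\ forall v, inst (join v e) j = inst v (r k).
  move=> k; case E: (r k) => [i|y]; first by exists (inl (inl i)).
  have [Ay|[j _ <-]] := rA _ _ E; first by exists (inr y); split=> // m [<-].
  by exists (inl (inr j)).
exists (fun w => sat f (inst w \o s)); split.
  by exists n, f, s; split=> // k; exact: (sP k).1.
move=> v; rewrite Xf; suff -> : inst v \o r = inst (join v e) \o s by [].
by apply/funext => k /=; rewrite (sP k).2.
Qed.

Lemma definable_point A V (i : V) m : A m -> definable A (fun v : V -> M => v i = m).
Proof.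
move=> Am; pose r : 'I_2 -> V + M := tcat (n := 1) (m := 1) (fun=> inl i) (fun=> inr m).
exists 2, (Equal (Var L (lshift 1 (ord0 : 'I_1))) (Var L (rshift 1 (ord0 : 'I_1)))), r.
split=> [k x|v].
  by rewrite /r /tcat; case: fintype.split => // ? [<-].
by rewrite /= /r tcatl tcatr.
Qed.

Lemma definable_eqv A V (i j : V) : definable A (fun v : V -> M => v i = v j).
Proof.
pose r : 'I_2 -> V + M := tcat (n := 1) (m := 1) (fun=> inl i) (fun=> inl j).
exists 2, (Equal (Var L (lshift 1 (ord0 : 'I_1))) (Var L (rshift 1 (ord0 : 'I_1)))), r.
split=> [k x|v].
  by rewrite /r /tcat; case: fintype.split.
by rewrite /= /r tcatl tcatr.
Qed.

End DefinableSets.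

(** * Types and forking *)

Section Types.
Variables (L : language) (M : structure L).

Lemma definable_sat_tcat A n m (f : formula L (n + m)) :
  definable A (fun w : 'I_n + 'I_m -> M => sat f (tcat (w \o inl) (w \o inr))).
Proof.
exists (n + m), f, (inl \o tcat inl inr); split=> // w.
suff -> : inst w \o (inl \o tcat inl inr) = tcat (w \o inl) (w \o inr) by [].
by apply/funext => k; rewrite /tcat /=; case: fintype.split.
Qed.

Lemma psat_definable A n (p : pformula M n) : Defs.over A p -> definable A (psat p).
Proof. by move=> pA; apply: definable_ext (definable_plug pA (definable_sat_tcat A (pform p))). Qed.

Lemma definable_pformula A n (X : ('I_n -> M) -> Prop) : definable A X ->
  exists2 p : pformula M n, Defs.over A p & psat p = X.
Proof.
move=> AX; have [m [g [rho [rhoA Xg]]]] := definable_split (definable_comp (@inl 'I_n void) AX).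
pose v0 (x : void) : M := match x with end.
exists (PFormula g (inst v0 \o rho)); last first.
  by apply/predeqP => u; rewrite /psat /= -Xg.
by move=> j /=; case E: (rho j) => [[]|x] /=; exact: rhoA E.
Qed.

(** Equality of types over [A]: one implication suffices because definable predicates are closed
    under negation. *)
Definition same_type A V (v w : V -> M) : Prop :=
  forall X : (V -> M) -> Prop, definable A X -> X v -> X w.

Lemma same_typeP A V (v w : V -> M) X : same_type A v w -> definable A X -> X v <-> X w.
Proof.
move=> vw AX; split; first exact: vw.
by move=> Xw; apply: contrapT => nXv; exact: (vw _ (definable_neg AX) nXv).
Qed.

Lemma same_type_sym A V (v w : V -> M) : same_type A v w -> same_type A w v.
Proof. by move=> vw X AX; rewrite (same_typeP vw AX). Qed.

Lemma same_type_trans A V (u v w : V -> M) : same_type A u v -> same_type A v w -> same_type A u w.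
Proof. by move=> uv vw X AX /(uv _ AX); exact: vw. Qed.

Lemma same_type_sub A B V (v w : V -> M) : A `<=` B -> same_type B v w -> same_type A v w.
Proof. by move=> AB vw X /(definable_sub AB); exact: vw. Qed.

Lemma same_type_comp A V W (v w : V -> M) (s : W -> V) :
  same_type A v w -> same_type A (v \o s) (w \o s).
Proof. by move=> vw X /(definable_comp s); exact: vw. Qed.

Lemma same_type_join A V W (v v' : V -> M) (w : W -> M) :
  same_type (A `|` range w) v v' -> same_type A (join v w) (join v' w).
Proof.
move=> vv' X AX; apply: (vv' (fun u => X (join u w))).
apply: definable_plug (definable_sub _ AX); last by move=> x; left.
by move=> j; right; exists j.
Qed.

Lemma tpP A n (a b : 'I_n -> M) : tp a A = tp b A <-> same_type A a b.
Proof.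
split=> [ab X AX Xa|ab].
  have [p pA pX] := definable_pformula AX.
  have : tp a A p by split=> //; rewrite pX.
  by rewrite ab => -[_]; rewrite pX.
apply/seteqP; split=> p [pA pa]; split=> //; apply: (_ : same_type A _ _) pa => //;
  by [exact: psat_definable|exact: same_type_sym].
Qed.

(** Since [F] is a filter base, finite satisfiability amounts to its members being nonempty. *)
Lemma saturated_definable K A n (F : set (('I_n -> M) -> Prop)) :
  saturated M K -> small K A ->
  (forall X, F X -> definable A X) -> (exists X, F X) ->
  (forall X Y, F X -> F Y -> exists2 Z, F Z & forall x, Z x -> X x /\ Y x) ->
  (forall X, F X -> exists x, X x) ->
  exists x, forall X, F X -> X x.
Proof.
move=> Msat Asm FA [X0 FX0] FI Fne.
pose S : set (pformula M n) := [set p | Defs.over A p /\ F (psat p)].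
have [||a aP] := Msat A Asm n S.
- by move=> p [].
- move=> N q qS.
  suff [Z FZ Zq] : exists2 Z, F Z & forall x, Z x -> forall i, psat (q i) x.
    by have [x Zx] := Fne _ FZ; exists x => i; exact: Zq.
  elim: N q qS => [|N IH] q qS; first by exists X0 => // x _ [].
  have [Z FZ ZP] := IH (q \o lift ord0) (fun i => qS _).
  have [Y FY YP] := FI _ _ FZ (qS ord0).2.
  exists Y => // x /YP[Zx q0] i; case: (unliftP ord0 i) => [j|] -> //.
  exact: ZP.
exists a => X FX; have [p pA pX] := definable_pformula (FA _ FX).
by rewrite -pX; apply: aP; split=> //; rewrite pX.
Qed.

Lemma eval_automorphism (g : M -> M) n (t : term L n) (v : 'I_n -> M) :
  automorphism g -> eval (g \o v) t = g (eval v t).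
Proof.
move=> [_ gF _]; elim: t => //= f ts IH; rewrite gF; congr (fint _).
exact/funext.
Qed.

Lemma sat_automorphism (g : M -> M) n (f : formula L n) (v : 'I_n -> M) :
  automorphism g -> sat f v <-> sat f (g \o v).
Proof.
move=> gA; have [[h gK hK] _ gR] := gA.
elim: f v => {n} /= [n|n t u|n r ts|n f IHf g' IHg|n f IHf] v //.
- rewrite !eval_automorphism //; split=> [->//|]; exact: (can_inj gK).
- rewrite gR; suff -> : g \o (fun j => eval v (ts j)) = fun j => eval (g \o v) (ts j) by [].
  by apply/funext => j; rewrite eval_automorphism.
- by rewrite IHf IHg.
- have E x : g \o tcat v (tsingle x) = tcat (g \o v) (tsingle (g x)).
    by rewrite tcat_comp.
  split=> H x; last by rewrite IHf E.
  by have /IHf := H (h x); rewrite E hK.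
Qed.

(** The map sending [v i] to [w i] and fixing [A] is partial elementary, and strong homogeneity
    extends it. *)
Lemma same_type_automorphism K A V (v w : V -> M) :
  strongly_homogeneous M K -> small K (A `|` range v) -> same_type A v w ->
  exists2 g : M -> M, automorphism g &
    g \o v = w /\ forall W (X : (W -> M) -> Prop), definable A X -> forall u, X u <-> X (g \o u).
Proof.
move=> Mhom Asm vw.
(* Equalities among the [v i], and between them and elements of [A], belong to the type; hence the
   choice of [i] is harmless and [h] fixes [A]. *)
pose h x := match pselect (exists i, x = v i) with
  | left e => w (projT1 (cid e)) | right _ => x end.
have hv i : h (v i) = w i.
  rewrite /h; case: pselect => [e|]; last by case; exists i.
  by case: cid => j /= vij; apply/esym/(vw _ (definable_eqv A i j) vij).
have hA x : A x -> h x = x.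
  move=> Ax; rewrite /h; case: pselect => // e; case: cid => j /= xj.
  exact: (vw _ (definable_point j Ax) (esym xj)).
have [|g gA gh] := Mhom _ h Asm.
  move=> n f u uA.
  have /choice[r rP] : forall i, exists x : V + M,
      (forall m, x = inr m -> A m) /\ inst v x = u i.
    move=> i; have [Ai|[j _ <-]] := uA i; last by exists (inl j).
    by exists (inr (u i)); split=> // m [<-].
  have := same_typeP vw (definable_form f (fun k => (rP k).1)).
  have -> : inst v \o r = u by apply/funext => i /=; rewrite (rP i).2.
  suff -> : inst w \o r = h \o u by [].
  apply/funext => i /=; have [rA <-] := rP i.
  by case E: (r i) => [j|m] //=; rewrite hA //; exact: rA.
exists g => //; split=> [|W X [n [f [r [rA Xf]]]] u].
  by apply/funext => i /=; rewrite gh ?hv //; right; exists i.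
rewrite !Xf (sat_automorphism _ _ gA).
suff -> : g \o (inst u \o r) = inst (g \o u) \o r by [].
apply/funext => k /=; case E: (r k) => [i|m] //=.
by have Am := rA _ _ E; rewrite gh ?hA //; left.
Qed.

End Types.

(** * Dividing, forking and nonforking extensions *)

Section Forking.
Variables (L : language) (M : structure L).

Definition inconsistent n V k (Y : ('I_n + V -> M) -> Prop) (E : nat -> V -> M) : Prop :=
  forall s : 'I_k -> nat, injective s -> ~ exists a, forall i, Y (join a (E (s i))).

Lemma dividesP B n (p : pformula M n) : divides B p ->
  exists k (E : nat -> 'I_(plen p) -> M), (forall i, same_type B (ppar p) (E i)) /\
    inconsistent k (fun w => sat (pform p) (tcat (w \o inl) (w \o inr))) E.
Proof.
move=> [k [E [EB Einc]]]; exists k, E; split=> // i.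
by apply/tpP; rewrite EB.
Qed.

(** Even for infinite [V] only finitely many coordinates occur in [Y], so the witness can be cut
    down to a [pformula]. *)
Lemma divides_of B n V (Y : ('I_n + V -> M) -> Prop) (e : V -> M) k (E : nat -> V -> M) :
  definable B Y -> (forall i, same_type B e (E i)) -> inconsistent k Y E ->
  exists2 p : pformula M n, divides B p & forall x, psat p x <-> Y (join x e).
Proof.
move=> BY eE Einc; have [m [g [rho [rhoB Yg]]]] := definable_split BY.
exists (PFormula g (inst e \o rho)); last by move=> x; rewrite Yg.
exists k, (fun i => inst (E i) \o rho); split=> /= [i|s sinj [a aP]].
  apply/tpP; apply: same_type_sym => X BX; apply: (eE i (fun w => X (inst w \o rho))).
  exact: definable_subst.
by apply: (Einc s sinj); exists a => i; rewrite Yg.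
Qed.

(** This is [formula_forks] for arbitrary predicates, which makes the forking sets an ideal. *)
Definition forking B n (Z : ('I_n -> M) -> Prop) : Prop :=
  exists N (q : 'I_N -> pformula M n), (forall i, divides B (q i)) /\
    forall a, Z a -> exists i, psat (q i) a.

Lemma forking_sub B n (Z Z' : ('I_n -> M) -> Prop) :
  (forall x, Z x -> Z' x) -> forking B Z' -> forking B Z.
Proof. by move=> ZZ' [N [q [qB Zq]]]; exists N, q; split=> // a /ZZ'/Zq. Qed.

Lemma forking_or B n (Z Z' : ('I_n -> M) -> Prop) :
  forking B Z -> forking B Z' -> forking B (fun x => Z x \/ Z' x).
Proof.
move=> [N [q [qB Zq]]] [N' [q' [qB' Zq']]]; exists (N + N'), (tcat q q'); split.
  by move=> i; rewrite /tcat; case: fintype.split.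
move=> a [/Zq[i qi]|/Zq'[i qi]]; first by exists (lshift _ i); rewrite tcatl.
by exists (rshift _ i); rewrite tcatr.
Qed.

Lemma forking_divides B n (p : pformula M n) : divides B p -> forking B (psat p).
Proof. by move=> pB; exists 1, (fun=> p); split=> // a pa; exists ord0. Qed.

Lemma forking_base B B' n (Z : ('I_n -> M) -> Prop) : B `<=` B' -> forking B' Z -> forking B Z.
Proof.
move=> BB' [N [q [qB Zq]]]; exists N, q; split=> // i.
have [k [E [EB Einc]]] := qB i; exists k, E; split=> // j.
by apply/tpP; apply: same_type_sub BB' _; apply/tpP.
Qed.

(* For small [A] this says that [tp c A] does not fork over [B] ([not_forksP]). *)
Definition nonforking B n (c : 'I_n -> M) A : Prop :=
  forall Z : ('I_n -> M) -> Prop, definable A Z -> Z c -> ~ forking B Z.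

Lemma nonforking_sub B n (c : 'I_n -> M) A A' : A' `<=` A -> nonforking B c A -> nonforking B c A'.
Proof. by move=> AA' cA Z /(definable_sub AA'); exact: cA. Qed.

Lemma nonforking_base B B' n (c : 'I_n -> M) A : B `<=` B' -> nonforking B c A -> nonforking B' c A.
Proof. by move=> BB' cA Z AZ Zc /(forking_base BB'); exact: cA. Qed.

(** A formula on the subtuple that divides still divides when read as a formula on the whole tuple,
    with the same witnesses. *)
Lemma nonforking_comp B n m (c : 'I_n -> M) (s : 'I_m -> 'I_n) A :
  nonforking B c A -> nonforking B (c \o s) A.
Proof.
move=> cA Z AZ Zc [N [q [qB Zq]]]; apply: (cA _ (definable_comp s AZ) Zc).
have /choice[q' q'P] : forall i, exists q' : pformula M n,
    divides B q' /\ forall x, psat q' x <-> psat (q i) (x \o s).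
  move=> i; have [k [E [EB Einc]]] := dividesP (qB i).
  pose Y (w : 'I_m + 'I_(plen (q i)) -> M) := sat (pform (q i)) (tcat (w \o inl) (w \o inr)).
  pose s' (x : 'I_m + 'I_(plen (q i))) : 'I_n + 'I_(plen (q i)) :=
    match x with inl i => inl (s i) | inr j => inr j end.
  have BY : definable B (fun w => Y (w \o s')) by apply: definable_comp; exact: definable_sat_tcat.
  have E' a b : join a b \o s' = join (a \o s) b by apply/funext => -[].
  have [|q' q'B q'E] := @divides_of B n _ _ (ppar (q i)) k E BY EB.
    move=> t tinj [a aP]; apply: (Einc t tinj); exists (a \o s) => j.
    by have := aP j; rewrite E'.
  by exists q'; split=> // x; rewrite q'E E'.
exists N, q'; split=> [i|a /Zq[i qi]]; first by have [] := q'P i.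
by exists i; rewrite (q'P i).2.
Qed.

(** A solution in [B] solves every conjugate of [p] over [B], against [k]-inconsistency. *)
Lemma divides_not_in_base B n (p : pformula M n) (a : 'I_n -> M) :
  (forall i, B (a i)) -> divides B p -> ~ psat p a.
Proof.
move=> aB [k [E [EB Einc]]] pa; apply: (Einc (@nat_of_ord k)); first exact: val_inj.
exists a => i; have /tpP/same_type_sym := EB i.
move/(_ (fun w => sat (pform p) (tcat a w))); apply=> //.
pose s (x : 'I_n + 'I_(plen p)) : 'I_(plen p) + M :=
  match x with inl i => inr (a i) | inr j => inl j end.
apply: definable_ext (@definable_subst _ _ B _ _ _ s _ (definable_sat_tcat B (pform p))) => //.
by move=> [j|j] m //= [<-].
Qed.

Lemma nonforking_in_base B n (a : 'I_n -> M) A : (forall i, B (a i)) -> nonforking B a A.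
Proof.
by move=> aB Z AZ Za [N [q [qB Zq]]]; have [i] := Zq _ Za; exact: (divides_not_in_base aB (qB i)).
Qed.

(** Otherwise [E] would witness that [Y] at [e] divides over [B], although it is true of [c] and its
    parameters lie in [A]. *)
Lemma nonforking_consistent B n (c : 'I_n -> M) A V (Y : ('I_n + V -> M) -> Prop) e
    (E : nat -> V -> M) k :
  nonforking B c A -> B `<=` A -> (forall j, A (e j)) -> definable B Y ->
  (forall i, same_type B e (E i)) -> Y (join c e) ->
  exists2 s : 'I_k -> nat, injective s & exists a, forall i, Y (join a (E (s i))).
Proof.
move=> cA BA eA BY eE Yc; apply: contrapT => nE.
have [|p pB pY] := @divides_of B n _ _ e k E BY eE.
  by move=> s sinj H; apply: nE; exists s.
apply: (cA (psat p)); last exact: forking_divides; last by rewrite pY.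
apply: definable_ext (definable_plug eA (definable_sub BA BY)) => x.
by rewrite pY.
Qed.

Variable K : Type.
Hypothesis Kinf : infinite_set [set: K].
Hypothesis small_cnt : forall A : set M, countable A -> small K A.
Hypothesis Msat : saturated M K.
Hypothesis Mhom : strongly_homogeneous M K.

Lemma small_range A (V : countType) (e : V -> M) : small K A -> small K (A `|` range e).
Proof.
move=> Asm; apply: small_setU => //; apply: small_cnt.
exact: card_le_trans (card_image_le _ _) (countableP _).
Qed.

(** By saturation over [A] and the parameters of [p], a type implying a forking [p] contains a
    single formula implying [p]. *)
Lemma not_forksP B n (c : 'I_n -> M) A : small K A ->
  ~ forks B (tp c A) <-> nonforking B c A.
Proof.
move=> Asm; split=> [ncA Z AZ Zc fZ|cA [p cp pB]].
  have [p pA pZ] := definable_pformula AZ; apply: ncA; exists p; last by rewrite -pZ in fZ.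
  by move=> a; apply; split=> //; rewrite pZ.
pose F : set (('I_n -> M) -> Prop) := [set X | exists Z, [/\ definable A Z, Z c &
  X = fun x => Z x /\ ~ psat p x]].
have [[X [Z [AZ Zc ->]] Zp]|] := pselect (exists2 X, F X & forall x, ~ X x).
  apply: (cA _ AZ Zc); apply: forking_sub (pB : forking B (psat p)) => x Zx.
  by apply: contrapT => px; exact: (Zp x (conj Zx px)).
move=> nF.
have [|||||x xF] := @saturated_definable _ _ K (A `|` range (ppar p)) n F Msat.
- exact: small_range.
- move=> X [Z [AZ Zc ->]]; apply: definable_and; first by apply: definable_sub AZ => x; left.
  by apply/definable_neg/psat_definable => j; right; exists j.
- by exists (fun x => True /\ ~ psat p x), (fun=> True); split=> //; exact: definable_True.
- move=> X Y [Z [AZ Zc ->]] [W [AW Wc ->]].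
  exists (fun x => (Z x /\ W x) /\ ~ psat p x); last by move=> x [[]].
  by exists (fun x => Z x /\ W x); split=> //; exact: definable_and.
- by move=> X FX; apply: contrapT => /forallNP nX; apply: nF; exists X.
have [|_ npx] := xF (fun x => True /\ ~ psat p x).
  by exists (fun=> True); split=> //; exact: definable_True.
apply: npx; apply: cp => q [qA qc].
have [] // := xF (fun x => psat q x /\ ~ psat p x).
by exists (psat q); split=> //; exact: psat_definable.
Qed.

(** The type of [c] over [A] is consistent with the negations of all forking formulas over [D]:
    otherwise one of its formulas would be covered by finitely many forking ones and so fork
    itself. *)
Lemma nonforking_extend B n (c : 'I_n -> M) A D : small K D -> A `<=` D -> nonforking B c A ->
  exists2 c', same_type A c c' & nonforking B c' D.
Proof.
move=> Dsm AD cA.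
pose F : set (('I_n -> M) -> Prop) := [set X | exists Z W, [/\ definable A Z, Z c,
  definable D W, forking B W & X = fun x => Z x /\ ~ W x]].
have FF : forking B (fun _ : 'I_n -> M => False).
  by exists 0, (@no_var _); split=> [[] //|//].
have [||||x xF] := @saturated_definable _ _ K D n F Msat Dsm.
- move=> X [Z [W [AZ Zc DW fW ->]]]; apply: definable_and; last exact: definable_neg.
  exact: definable_sub AZ.
- exists (fun x => True /\ ~ False), (fun=> True), (fun=> False).
  by split=> //; [exact: definable_True|exact: definable_False].
- move=> X X' [Z [W [AZ Zc DW fW ->]]] [Z' [W' [AZ' Zc' DW' fW' ->]]].
  exists (fun x => (Z x /\ Z' x) /\ ~ (W x \/ W' x)).
    exists (fun x => Z x /\ Z' x), (fun x => W x \/ W' x).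
    by split=> //; [exact: definable_and|exact: definable_or|exact: forking_or].
  by move=> x [[Zx Zx'] nW]; split; split=> // Wx; apply: nW; [left|right].
- move=> X [Z [W [AZ Zc DW fW ->]]]; apply: contrapT => nX.
  apply: (cA _ AZ Zc); apply: forking_sub fW => x Zx.
  by apply: contrapT => Wx; apply: nX; exists x.
exists x => [X AX Xc|Z DZ Zx fZ].
  have [] // := xF (fun x => X x /\ ~ False).
  by exists X, (fun=> False); split=> //; exact: definable_False.
have [] // := xF (fun x => True /\ ~ Z x).
by exists (fun=> True), Z; split=> //; exact: definable_True.
Qed.

(** An automorphism over [A] carries [a] to [a']. It preserves the type over [B] of the parameters
    of each dividing formula, so the same sequences [E] still witness dividing. *)
Lemma forking_same_type A B n (V : countType) (Y : ('I_n + V -> M) -> Prop) (a a' : V -> M) :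
  small K A -> B `<=` A -> definable A Y -> same_type A a a' ->
  forking B (fun x => Y (join x a)) -> forking B (fun x => Y (join x a')).
Proof.
move=> Asm BA AY aa' [N [q [qB Yq]]].
have [g gA [ga gX]] := same_type_automorphism Mhom (small_range a Asm) aa'.
have [[h gK hK] _ _] := gA.
exists N, (fun i => PFormula (pform (q i)) (g \o ppar (q i))); split.
  move=> i; have [k [E [EB Einc]]] := qB i; exists k, E; split=> // j.
  rewrite EB; apply/tpP => X BX; rewrite -gX //.
  exact: definable_sub BX.
move=> x; have <- : g \o (h \o x) = x by apply/funext => j /=.
have <- : g \o join (h \o x) a = join (g \o (h \o x)) a'.
  by rewrite -ga; apply/funext => -[].
rewrite -gX // => /Yq[i qi]; exists i; rewrite /psat /=.
by rewrite -tcat_comp -sat_automorphism.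
Qed.

Lemma nonforking_same_type_join A B n (V : countType) (c c' : 'I_n -> M) (a a' : V -> M) :
  small K A -> B `<=` A -> same_type A (join c a) (join c' a') ->
  nonforking B c (A `|` range a) -> nonforking B c' (A `|` range a').
Proof.
move=> Asm BA ca cA Z /definable_range[Y [AY ZY]] Zc' fZ.
have aa' : same_type A a a' := same_type_comp (s := @inr 'I_n V) ca.
apply: (cA (fun x => Y (join x a))).
- apply: definable_plug (definable_sub _ AY); last by move=> x; left.
  by move=> j; right; exists j.
- by rewrite (same_typeP ca AY) -ZY.
- apply: (@forking_same_type A B n V Y a' a) => //; first exact: same_type_sym aa'.
  by apply: forking_sub fZ => x; rewrite ZY.
Qed.

Lemma same_type_extend A V W (v v' : V -> M) (w : W -> M) :
  small K (A `|` range v) -> same_type A v v' ->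
  exists w' : W -> M, same_type A (join v w) (join v' w').
Proof.
move=> Asm vv'; have [g gA [gv gX]] := same_type_automorphism Mhom Asm vv'.
exists (g \o w) => X AX; rewrite (gX _ _ AX).
suff -> : g \o join v w = join v' (g \o w) by [].
by rewrite -gv; apply/funext => -[].
Qed.

End Forking.

(** * Indiscernible sequences in NIP theories *)

Section Expansions.
Variables (L : language) (I : Type).
Let L' := unary_expansion_language L I.

Fixpoint lift_term n (t : term L n) : term L' n :=
  match t with
  | Var i => Var L' i
  | App f ts => @App L' n f (fun j => lift_term (ts j))
  end.

Fixpoint lift_formula n (f : formula L n) : formula L' n :=
  match f in formula _ k return formula L' k with
  | Bot _ => Bot
  | Equal _ t u => Equal (lift_term t) (lift_term u)
  | Atom _ r ts => @Atom L' _ (inl r) (fun j => lift_term (ts j))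
  | Imp _ f g => Imp (lift_formula f) (lift_formula g)
  | All _ f => All (lift_formula f)
  end.

Variables (M : structure L) (P : I -> set M).
Let M' := unary_expansion P.

Lemma eval_lift n (t : term L n) (v : 'I_n -> M) :
  @eval L' M' n v (lift_term t) = eval v t.
Proof. by elim: t => //= f ts IH; congr (fint _); apply/funext. Qed.

Lemma sat_lift n (f : formula L n) (v : 'I_n -> M) :
  @sat L' M' n (lift_formula f) v <-> sat f v.
Proof.
elim: f v => {n} /= [n|n t u|n r ts|n f IHf g IHg|n f IHf] v //.
- by rewrite !eval_lift.
- rewrite (_ : (fun j => @eval L' M' n v _) = (fun j => eval v (ts j))) //.
  by apply/funext => j; rewrite eval_lift.
- by rewrite IHf IHg.
- by split=> H x; have /IHf := H x.
Qed.

Lemma definable_lift A V (X : (V -> M) -> Prop) : definable A X -> @definable L' M' A V X.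
Proof.
move=> [n [f [r [rA Xf]]]]; exists n, (lift_formula f), r; split=> // v.
by rewrite Xf -sat_lift.
Qed.

Lemma definable_unary A V i (x : V) : @definable L' M' A V (fun v => P i (v x)).
Proof. by exists 1, (@Atom L' 1 (inr i) (fun=> Var L' ord0)), (fun=> inl x). Qed.

End Expansions.

(** The independence property for predicates whose two tuples of variables may be infinite. *)
Definition shatters T V W (X : (V + W -> T) -> Prop) : Prop :=
  forall N, exists (a : 'I_N -> V -> T) (b : {set 'I_N} -> W -> T),
    forall i S, X (fun x => match x with inl v => a i v | inr w => b S w end) <-> i \in S.

Lemma NIP_not_shatters L (M : structure L) V W (X : (V + W -> M) -> Prop) :
  NIP (Th M) -> definable setT X -> ~ shatters X.
Proof.
move=> MNIP [n [f [r [_ Xf]]]] Xsh; have [x0] := dom_inhabited M.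
pose s k := if r k is inl (inl _) then lshift n k else rshift n k.
apply: (MNIP n n (ren f s)) => N; exists M; split=> //.
have [a [b ab]] := Xsh N.
exists (fun i k => if r k is inl (inl v) then a i v else x0).
exists (fun S k => match r k with inl (inr w) => b S w | inr m => m | _ => x0 end).
move=> i S; rewrite -ab Xf sat_ren.
set u := (X in sat f X <-> _); set v := (X in _ <-> sat f X).
suff -> : u = v by [].
by apply/funext => k; rewrite /u /v /= /s; case E: (r k) => [[x|w]|m]; rewrite ?tcatl ?tcatr E.
Qed.

Definition reindex T J (g : nat -> nat) (e : nat * J -> T) : nat * J -> T :=
  fun p => e (g p.1, p.2).

Section Indiscernibles.
Variables (L : language) (M : structure L).

(** Every finite increasing list of indices is the beginning of a strictly increasing [g], so this
    is the usual indiscernibility over [A] of a sequence of [J]-tuples. *)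
Definition indiscernible A J (e : nat * J -> M) : Prop :=
  forall X, definable A X -> forall g : nat -> nat, {homo g : i j / i < j} ->
    X e <-> X (reindex g e).

Lemma indiscernible_same_type A J (e : nat * J -> M) (g : nat -> nat) :
  indiscernible A e -> {homo g : i j / i < j} -> same_type A e (reindex g e).
Proof. by move=> eA gi X AX; rewrite (eA X AX g gi). Qed.

Hypothesis MNIP : forall V W (X : (V + W -> M) -> Prop), definable setT X -> ~ shatters X.

(* If [X] separated [c] along the blocks [alpha] and [addn R], then, as its type
   does not divide, so would a common point along many translates of these
   blocks; choosing one block in each pair realises every pattern. *)
Lemma indiscernible_nonforking_block B A n (c : 'I_n -> M) J (e : nat * J -> M)
    (X : ('I_n + nat * J -> M) -> Prop) N R (alpha : nat -> nat) :
  indiscernible B e -> nonforking B c A -> B `<=` A -> (forall p, A (e p)) ->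
  definable B X -> 0 < N ->
  (forall x v w, (forall i j, i < N -> v (i, j) = w (i, j)) ->
    X (join x v) <-> X (join x w)) ->
  {homo alpha : i j / i < j} -> (forall i, i < N -> alpha i < R) ->
  X (join c (reindex alpha e)) -> X (join c (reindex (addn R) e)).
Proof.
move=> eB cA BA eA BX N0 Xsupp alphai alphaR Xa; apply: contrapT => nXb.
(* A stretch of this length contains the first [N] places of both blocks, since [alpha] stays below
   [R] there. *)
pose m := R + N.
pose re g (x : 'I_n + nat * J) : 'I_n + nat * J :=
  match x with inl i => inl i | inr p => inr (g p.1, p.2) end.
have reE g x w : join x w \o re g = join x (reindex g w) by apply/funext => -[].
pose Y (w : 'I_n + nat * J -> M) := X (w \o re alpha) /\ ~ X (w \o re (addn R)).
have BY : definable B Y by apply: definable_and; [|apply: definable_neg]; exact: definable_comp.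
pose E j := reindex (addn (m * j)) e.
have eE j : same_type B e (E j) by apply: indiscernible_same_type => // x y; rewrite ltn_add2l.
have Yc : Y (join c e) by rewrite /Y !reE.
pose sw (x : 'I_n + nat * J) : nat * J + 'I_n :=
  match x with inl i => inr i | inr p => inl p end.
have := @MNIP _ _ (fun w => X (w \o sw)); apply.
  by apply: definable_comp; apply: definable_sub BX.
move=> k; have [s sinj [a aY]] := nonforking_consistent k cA BA eA BY eE Yc.
pose rho (i : 'I_k) l := N * s i + l.
have /choice[b bP] : forall S : {set 'I_k}, exists x, forall i : 'I_k,
    X (join x (reindex (rho i) e)) <-> i \in S.
  move=> S.
  pose Q (v : nat * J -> M) := exists x, forall i : 'I_k,
    if i \in S then X (join x (reindex (rho i) v)) else ~ X (join x (reindex (rho i) v)).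
  have BQ : definable B Q.
    have /definable_ex : definable B (fun w : 'I_n + nat * J -> M => forall i : 'I_k,
        if i \in S then X (w \o re (rho i)) else ~ X (w \o re (rho i))).
      apply: definable_forall_ord => i; case: (i \in S); last apply: definable_neg;
      exact: definable_comp.
    by apply: definable_ext => v; split=> -[x xP]; exists x => i; move: (xP i); rewrite reE.
  pose inS q := [exists i in S, s i == q].
  (* In the stretch number [q], [g] picks the block [alpha] if [q] is [s i] for some [i] in [S], and
     the block from [R] on otherwise. As [g] is increasing, indiscernibility moves this pattern to
     the places [rho i], which do not depend on [S]. *)
  pose g y := m * (y %/ N) + (if inS (y %/ N) then alpha (y %% N) else R + y %% N).
  have gm y : g y < m * (y %/ N).+1.
    rewrite /g mulnS addnC ltn_add2r /m; have lt := ltn_pmod y N0.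
    case: ifP => _; last by rewrite ltn_add2l.
    by apply: leq_trans (alphaR _ lt) _; exact: leq_addr.
  have gi : {homo g : x y / x < y}.
    move=> x y xy; have [lt|eq] : x %/ N < y %/ N \/ x %/ N = y %/ N.
      by have := leq_div2r N (ltnW xy); rewrite leq_eqVlt => /orP[/eqP|]; [right|left].
      apply: leq_trans (gm x) _; apply: leq_trans (leq_addr _ _).
      by rewrite leq_mul2l lt orbT.
    have lt : x %% N < y %% N.
      by move: xy; rewrite {1}(divn_eq x N) {1}(divn_eq y N) eq ltn_add2l.
    by rewrite /g eq ltn_add2l; case: ifP => _; [exact: alphai|rewrite ltn_add2l].
  have Qg : Q (reindex g e).
    exists a => i; have [] := aY i; rewrite /E !reE => Ya Yb.
    have gE l : l < N -> g (rho i l) = m * s i + if i \in S then alpha l else R + l.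
      move=> lN; rewrite /g /rho [N * _]mulnC divnMDl // divn_small // addn0 modnMDl modn_small //.
      suff -> : inS (s i) = (i \in S) by [].
      apply/existsP/idP => [[j /andP[jS /eqP/sinj <-//]]|iS].
      by exists i; rewrite iS eqxx.
    have bl (h : nat -> nat) : (forall l, l < N -> g (rho i l) = m * s i + h l) ->
        X (join a (reindex (rho i) (reindex g e))) <->
        X (join a (reindex h (reindex (addn (m * s i)) e))).
      by move=> gh; apply: Xsupp => l j lN; rewrite /reindex /= gh.
    case: ifP => iS; last move: Yb; last apply: contra_not.
      by apply/(bl alpha _).2 => // l /gE; rewrite iS.
    by apply/(bl (addn R) _).1 => // l /gE; rewrite iS.
  have [x xP] := (eB Q BQ g gi).2 Qg.
  by exists x => i; have := xP i; case: (i \in S).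
exists (fun i => reindex (rho i) e), b => i S; rewrite -bP.
have E' y z : (fun x : nat * J + 'I_n => match x with inl p => y p | inr j => z j end) \o sw
    = join z y :> ('I_n + nat * J -> M) by apply/funext => -[].
by rewrite E'.
Qed.

(** The block lemma, applied to a formula and to its negation, compares both [e] and its reindexing
    by [g] with one common block to the right of them. *)
Lemma indiscernible_nonforking B A n (c : 'I_n -> M) J (e : nat * J -> M) :
  indiscernible B e -> nonforking B c A -> B `<=` A -> (forall p, A (e p)) ->
  indiscernible (B `|` range c) e.
Proof.
move=> eB cA BA eA X0 /definable_range[Y [BY XY]] g gi; rewrite !XY {X0 XY}.
pose sw (x : nat * J + 'I_n) : 'I_n + nat * J :=
  match x with inl p => inr p | inr i => inl i end.
pose X (w : 'I_n + nat * J -> M) := Y (w \o sw).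
have BX : definable B X by exact: definable_comp.
have YX v : Y (join v c) <-> X (join c v).
  by rewrite /X; suff -> : join c v \o sw = join v c by []; apply/funext => -[].
rewrite !YX.
(* The successor makes the block length positive. *)
have [N0 NX0] := definable_support BX; pose N := N0.+1.
have NX x v w : (forall i j, i < N -> v (i, j) = w (i, j)) -> X (join x v) <-> X (join x w).
  by move=> vw; apply: NX0 => i j /ltnW iN; exact: vw.
have key (Z : ('I_n + nat * J -> M) -> Prop) R alpha : definable B Z ->
    (forall x v w, (forall i j, i < N -> v (i, j) = w (i, j)) ->
      Z (join x v) <-> Z (join x w)) ->
    {homo alpha : i j / i < j} -> (forall i, i < N -> alpha i < R) ->
    Z (join c (reindex alpha e)) -> Z (join c (reindex (addn R) e)).
  by move=> BZ ZN; exact: (indiscernible_nonforking_block eB cA BA eA BZ (ltn0Sn N0) ZN).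
have key2 R alpha : {homo alpha : i j / i < j} -> (forall i, i < N -> alpha i < R) ->
    X (join c (reindex alpha e)) <-> X (join c (reindex (addn R) e)).
  move=> alphai alphaR; split; first exact: key.
  move=> Xb; apply: contrapT => nXa; apply: (key (fun w => ~ X w) R alpha) nXa _ => //.
    exact: definable_neg.
  by move=> x v w vw; rewrite (NX x v w vw).
have gN i : i <= g i.
  by elim: i => // i IH; apply: leq_ltn_trans IH (gi _ _ (ltnSn i)).
have iR i : i < N -> i < g N by move=> iN; exact: leq_trans (gN N).
rewrite (key2 (g N) g gi) => [|i iN]; last exact: gi.
rewrite -(key2 (g N) id) //.
by suff -> : reindex id e = e by []; apply/funext => -[].
Qed.

End Indiscernibles.

(** * Limits along an ultrafilter and left transitivity *)

Lemma nonprincipal_ultrafilter :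
  exists U : set_system nat, UltraFilter U /\ forall N, U [set t | N < t].
Proof.
have [U [UU sU]] := ultraFilterLemma eventually_filter.
exists U; split=> // N; apply: sU; exists N.+1 => //.
Qed.

Section Limits.
Variables (L : language) (M : structure L) (K : Type).
Hypothesis Kinf : infinite_set [set: K].
Hypothesis small_cnt : forall A : set M, countable A -> small K A.
Hypothesis Msat : saturated M K.
Hypothesis Mhom : strongly_homogeneous M K.

(* A Morley sequence of the limit of [e] along an ultrafilter. *)
Lemma indiscernible_limit B l (e : nat -> 'I_l -> M) : small K B ->
  exists a : nat * 'I_l -> M, indiscernible B a /\
    forall X, definable B X -> X a ->
      exists2 tau : nat -> nat, injective tau & X (fun p => e (tau p.1) p.2).
Proof.
move=> Bsm; have [U [UU Uinf]] := nonprincipal_ultrafilter.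
have UF : ProperFilter U by exact: ultra_proper.
pose B' := B `|` range (fun p : nat * 'I_l => e p.1 p.2).
have Bsm' : small K B' by exact: small_range.
have BB' : B `<=` B' by move=> x; left.
have eB' t j : B' (e t j) by right; exists (t, j).
(* [F D] realizes the limit type over [D], made of the formulas true of [e t] for [U]-almost all
   [t]; [e 0] is a default value for [D] not small. *)
have /choice[F FP] : forall D : set M, exists x : 'I_l -> M, small K D ->
    forall X, definable D X -> X x <-> U [set t | X (e t)].
  move=> D; have [Dsm|nD] := pselect (small K D); last first.
    by exists (e 0) => Dsm; case: nD.
  have [||||x xF] := @saturated_definable _ _ K D l
      [set X | definable D X /\ U [set t | X (e t)]] Msat Dsm.
  - by move=> X [].
  - by exists (fun=> True); split; [exact: definable_True|exact: filterT].
  - move=> X Y [DX UX] [DY UY]; exists (fun x => X x /\ Y x) => //.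
    by split; [exact: definable_and|exact: filterI].
  - by move=> X [_ /filter_ex[t Xt]]; exists (e t).
  exists x => _ X DX; split=> [Xx|UX]; last exact: xF.
  have [//|UnX] := in_ultra_setVsetC [set t | X (e t)] UU.
  by case: (xF (fun x => ~ X x)) => //; split=> //; exact: definable_neg.
pose fix D n := if n is n'.+1 then D n' `|` range (F (D n')) else B'.
have Dsm n : small K (D n) by elim: n => //= n IH; exact: small_range.
have DD m n : m <= n -> D m `<=` D n.
  elim: n => [|n IH]; first by rewrite leqn0 => /eqP ->.
  by rewrite leq_eqVlt => /orP[/eqP ->//|/IH mn x /mn]; left.
pose a (p : nat * 'I_l) := F (D p.1) p.2.
have aD i n j : i < n -> D n (a (i, j)).
  by move=> /DD; apply; right; exists j.
(* All terms from the [N]-th on become [e t]; for a predicate that sees [N.+1] terms this replaces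
   only the last one. *)
pose plug N t (v : nat * 'I_l -> M) (p : nat * 'I_l) :=
  if p.1 < N then v p else e t p.2.
pose supp N (X : (nat * 'I_l -> M) -> Prop) := forall v w,
  (forall i j, i < N -> v (i, j) = w (i, j)) -> X v <-> X w.
have plug_definable N t X : definable B' X -> definable B' (fun v => X (plug N t v)).
  move=> BX; pose s (p : nat * 'I_l) : nat * 'I_l + M :=
    if p.1 < N then inl p else inr (e t p.2).
  apply: definable_ext (@definable_subst _ _ B' _ _ X s _ BX) => [v|p m].
    suff -> : inst v \o s = plug N t v by [].
    by apply/funext => p; rewrite /s /plug /=; case: ifP.
  by rewrite /s; case: ifP => // _ [<-].
have plug_supp N t X : supp N (fun v => X (plug N t v)).
  move=> v w vw; suff -> : plug N t v = plug N t w by [].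
  by apply/funext => -[i j]; rewrite /plug /=; case: ifP => // /vw.
(* The earlier terms lie in [D (g N)], over which the term [g N] realizes the limit type. Trading it
   for [e t] leaves a predicate in [N] terms, on which the inductions below rest. *)
have step N X (g : nat -> nat) : definable B' X -> supp N.+1 X -> {homo g : i j / i < j} ->
    X (reindex g a) <-> U [set t | X (plug N t (reindex g a))].
  move=> BX XN gi.
  pose Z (x : 'I_l -> M) := X (fun p => if p.1 < N then reindex g a p else x p.2).
  have DZ : definable (D (g N)) Z.
    pose s (p : nat * 'I_l) : 'I_l + M :=
      if p.1 < N then inr (reindex g a p) else inl p.2.
    have BX' : definable (D (g N)) X by apply: definable_sub BX; exact: (DD 0).
    apply: definable_ext (definable_subst (s := s) _ BX') => [x|p m].
      suff -> : inst x \o s = fun p => if p.1 < N then reindex g a p else x p.2 by [].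
      by apply/funext => p; rewrite /s /=; case: ifP.
    by rewrite /s; case: ifP => // pN [<-]; apply: aD; exact: gi.
  rewrite -(FP _ (Dsm _) _ DZ); apply: XN => i j; rewrite ltnS leq_eqVlt /reindex /=.
  by case: ltnP => // _; rewrite orbF => /eqP ->.
have shiftE N X g : definable B' X -> supp N X -> {homo g : i j / i < j} ->
    X a <-> X (reindex g a).
  elim: N X => [|N IH] X BX XN gi; first exact: XN.
  have aE : a = reindex id a by apply/funext => -[].
  rewrite [in X in X <-> _]aE (step N) // (step N X g) //.
  suff -> : [set t | X (plug N t (reindex id a))] = [set t | X (plug N t (reindex g a))] by [].
  apply/predeqP => t; rewrite /= -aE.
  apply: (IH (fun v => X (plug N t v))) => //; exact: plug_definable.
(* Terms are replaced from the last to the first, each with an index above those already used; the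
   bound [b] thus ensures injectivity. *)
have realE N X b : definable B' X -> supp N X -> X a ->
    exists tau : nat -> nat, [/\ injective tau, forall i, b < tau i &
      X (fun p => e (tau p.1) p.2)].
  elim: N X b => [|N IH] X b BX XN Xa.
    exists (fun i => b + i.+1); split=> [i j /addnI[]//|i|].
      by rewrite addnS ltnS leq_addr.
    by rewrite -(XN a).
  have aE : a = reindex id a by apply/funext => -[].
  have : U [set t | X (plug N t a)] by rewrite aE -(step N X id) // -aE.
  move=> /(filterI (Uinf b))/filter_ex[t [bt Xt]].
  have [tau [taui taut Xtau]] := IH _ t (plug_definable N t X BX) (plug_supp N t X) Xt.
  exists (fun i => if i == N then t else tau i); split.
  - move=> i j; case: eqP => [->|_]; case: eqP => [->|_] // E.
    + by have := taut j; rewrite -E ltnn.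
    + by have := taut i; rewrite E ltnn.
    + exact: taui.
  - by move=> i; case: eqP => // _; exact: ltn_trans bt (taut i).
  - refine ((XN _ _ _).1 Xtau) => i j; rewrite ltnS leq_eqVlt /plug /=.
    by case: eqP => [->|_ /= ->//]; rewrite ltnn.
have suppE X : definable B X -> exists N, supp N X.
  move=> BX; have [N NX] := definable_support (definable_comp (@inr void (nat * 'I_l)) BX).
  pose v0 (x : void) : M := match x with end.
  by exists N => v w vw; exact: (NX v0).
exists a; split=> [X BX g gi|X BX Xa].
  have [N NX] := suppE _ BX; exact: (shiftE N X g (definable_sub BB' BX)).
have [N NX] := suppE _ BX.
by have [tau [taui _ Xtau]] := realE N X 0 (definable_sub BB' BX) NX Xa; exists tau.
Qed.

(** The limit of [E] inherits [k]-inconsistency, as a consistent choice of [k] terms would be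
    reflected in [E] at distinct indices. Its first term has the type of [e] over [B], and an
    automorphism moves it to [e]. *)
Lemma divides_indiscernible B n l (Y : ('I_n + 'I_l -> M) -> Prop) (e : 'I_l -> M) k E :
  small K B -> definable B Y -> (forall i, same_type B e (E i)) -> inconsistent k Y E ->
  exists a : nat * 'I_l -> M, [/\ indiscernible B a, forall j, a (0, j) = e j &
    inconsistent k Y (fun i j => a (i, j))].
Proof.
move=> Bsm BY eE Einc; have [a [aB aE]] := indiscernible_limit E Bsm.
have ainc : inconsistent k Y (fun i j => a (i, j)).
  move=> s sinj ea.
  pose Q (v : nat * 'I_l -> M) := exists x, forall i : 'I_k,
    Y (join x (fun j => v (s i, j))).
  have BQ : definable B Q.
    pose re (i : 'I_k) (x : 'I_n + 'I_l) : 'I_n + nat * 'I_l :=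
      match x with inl i => inl i | inr j => inr (s i, j) end.
    have /definable_ex : definable B (fun w : 'I_n + nat * 'I_l -> M => forall i : 'I_k,
        Y (w \o re i)).
      by apply: definable_forall_ord => i; exact: definable_comp.
    apply: definable_ext => v; split=> -[x xP]; exists x => i; move: (xP i);
      by rewrite (_ : join x v \o re i = join x (fun j => v (s i, j))) //; apply/funext => -[].
  have [tau taui Qtau] := aE Q BQ ea.
  exact: (Einc (tau \o s) (inj_comp taui sinj)).
have a0 : same_type B (fun j => a (0, j)) e.
  move=> X BX Xa; have [tau _ Xtau] := aE _ (definable_comp (fun j => (0, j)) BX) Xa.
  exact: (same_type_sym (eE (tau 0)) BX Xtau).
have [g gA [ga gX]] := same_type_automorphism Mhom (small_range Kinf small_cnt _ Bsm) a0.
exists (g \o a); split=> [X BX h hi|j|s sinj [x xP]].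
- by have := aB _ BX h hi; rewrite (gX _ _ BX a) (gX _ _ BX (reindex h a)).
- exact: (congr1 (@^~ j) ga).
- have [[g' gK gK'] _ _] := gA.
  apply: (ainc s sinj); exists (g' \o x) => i; rewrite (gX _ _ BY).
  by rewrite (_ : g \o _ = join x (fun j => (g \o a) (s i, j))) //; apply/funext => -[u|u] /=.
Qed.

Hypothesis MNIP : forall V W (X : (V + W -> M) -> Prop), definable setT X -> ~ shatters X.

(** Left transitivity. Take indiscernible witnesses for the dividing formulas that cover [Z]; move
    [c], then [a], so that neither forks with these witnesses. The sequences stay indiscernible over
    the moved tuples, so a dividing formula true of them at the first term is true at every term,
    against [k]-inconsistency. *)
Lemma nonforking_tcat A B n m (a : 'I_n -> M) (c : 'I_m -> M) :
  small K A -> B `<=` A -> nonforking B c A -> nonforking B a (A `|` range c) ->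
  nonforking B (tcat a c) A.
Proof.
move=> Asm BA cA aA Z AZ Zac [N [q [qB Zq]]].
have eP i : {e : nat * 'I_(plen (q i)) -> M & {k | [/\ indiscernible B e,
    forall j, e (0, j) = ppar (q i) j &
    inconsistent k (fun w => sat (pform (q i)) (tcat (w \o inl) (w \o inr)))
      (fun i j => e (i, j))]}}.
  have [k /cid[E [EB Einc]]] := cid (dividesP (qB i)).
  have [|e eP] := cid (divides_indiscernible (small_sub BA Asm) _ EB Einc).
    exact: definable_sat_tcat.
  by exists e, k.
pose e i := projT1 (eP i).
pose D := A `|` range (fun x : {i : 'I_N & (nat * 'I_(plen (q i)))%type} => e (tag x) (tagged x)).
have Dsm : small K D by exact: small_range.
have eD i p : D (e i p) by right; exists (existT _ i p).
have AD : A `<=` D by move=> x; left.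
have [c' cc' c'D] := nonforking_extend Msat Dsm AD cA.
have [a' aa'] := same_type_extend Mhom a (small_range Kinf small_cnt c Asm) cc'.
pose sw n m (x : 'I_n + 'I_m) : 'I_m + 'I_n :=
  match x with inl i => inr i | inr i => inl i end.
have swE n' m' (x : 'I_n' -> M) (y : 'I_m' -> M) : join x y \o sw _ _ = join y x.
  by apply/funext => -[].
have aa : same_type A (join a c) (join a' c').
  by rewrite -swE -(swE _ _ c' a'); exact: same_type_comp.
have a'A := nonforking_same_type_join Kinf small_cnt Mhom Asm BA aa aA.
have D'sm := small_range Kinf small_cnt c' Dsm.
have [|a'' aa'' a''D] := nonforking_extend Msat D'sm _ a'A.
  by move=> x [/AD|]; [left|right].
have Zac'' : Z (tcat a'' c').
  have := definable_comp (@fintype.split n m) AZ => AZ'.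
  by apply: (same_type_trans aa (same_type_join aa'') AZ').
have [i qi] := Zq _ Zac''.
have [k [eB e0 einc]] := projT2 (eP i); rewrite -/(e i) in eB e0 einc.
have eBc : indiscernible (B `|` range c') (e i).
  by apply: indiscernible_nonforking eB c'D _ (eD i) => // x /BA/AD.
have eBca : indiscernible (B `|` range c' `|` range a'') (e i).
  apply: (indiscernible_nonforking MNIP eBc (nonforking_base _ a''D)) => //.
  - by move=> x [/BA/AD|]; [left|right].
  - by move=> p; left; exact: eD.
pose X (v : nat * 'I_(plen (q i)) -> M) :=
  sat (pform (q i)) (tcat (tcat a'' c') (fun j => v (0, j))).
have BX : definable (B `|` range c' `|` range a'') X.
  pose s (x : 'I_(n + m) + 'I_(plen (q i))) : nat * 'I_(plen (q i)) + M :=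
    match x with inl x => inr (tcat a'' c' x) | inr j => inl (0, j) end.
  apply: definable_ext (definable_subst (s := s) _ (definable_sat_tcat _ (pform (q i))))
    => // -[x|//] y [<-].
  rewrite /tcat; case: fintype.split => u; first by right; exists u.
  by left; right; exists u.
have Xe : X (e i).
  by rewrite /X (_ : (fun j => e i (0, j)) = ppar (q i)) //; apply/funext => j; exact: e0.
apply: (einc (@nat_of_ord k)); first exact: val_inj.
exists (tcat a'' c') => t.
have tt : {homo addn t : x y / x < y} by move=> x y; rewrite ltn_add2l.
by have := (eBca X BX _ tt).1 Xe; rewrite /X /reindex /= addn0.
Qed.

End Limits.

(** * Coding a grid *)

Lemma ultrafilter_color (U : set_system nat) (C : finType) (f : nat -> C) :
  UltraFilter U -> exists c, U [set t | f t = c].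
Proof.
move=> UU; apply: contrapT => /forallNP nU.
have /filter_ex[t tP] : U [set t | forall c, f t <> c].
  apply: (@filter_forall _ C (fun c t => f t <> c) U) => c.
  by have [/nU|] := in_ultra_setVsetC [set t | f t = c] UU.
exact: (tP (f t)).
Qed.

(** [F3], [F2], [F1] and [c] are iterated limit colours along [U]. Each new value of [h] is chosen
    so that all limits formed from earlier values are attained there. *)
Lemma ramsey4 (C : finType) (F : nat -> nat -> nat -> nat -> C) :
  exists h : nat -> nat, {homo h : i j / i < j} /\ exists c, forall i j k l,
    i < j -> j < k -> k < l -> F (h i) (h j) (h k) (h l) = c.
Proof.
have [U [UU Uinf]] := nonprincipal_ultrafilter.
have UF : ProperFilter U by exact: ultra_proper.
have /choice[lim limP] := fun f => ultrafilter_color (C := C) f UU.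
pose F3 i j k := lim (F i j k); pose F2 i j := lim (F3 i j).
pose F1 i := lim (F2 i); pose c := lim F1.
have /choice[g gP] : forall b, exists x, [/\ b < x, F1 x = c,
    forall i, i <= b -> F2 i x = F1 i,
    forall i j, i <= b -> j <= b -> F3 i j x = F2 i j &
    forall i j k, i <= b -> j <= b -> k <= b -> F i j k x = F3 i j k].
  move=> b.
  pose S2 : set nat := fun x => forall i : 'I_b.+1, F2 i x = F1 i.
  pose S3 : set nat := fun x => forall p : 'I_b.+1 * 'I_b.+1, F3 p.1 p.2 x = F2 p.1 p.2.
  pose S4 : set nat := fun x => forall p : 'I_b.+1 * 'I_b.+1 * 'I_b.+1,
    F p.1.1 p.1.2 p.2 x = F3 p.1.1 p.1.2 p.2.
  have U2 : U S2 by apply: filter_forall => i; exact: limP.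
  have U3 : U S3 by apply: filter_forall => p; exact: limP.
  have U4 : U S4 by apply: filter_forall => p; exact: limP.
  have /filter_ex[x [bx [x1 [x2 [x3 x4]]]]] :
      U ([set t | b < t] `&` ([set t | F1 t = c] `&` (S2 `&` (S3 `&` S4)))).
    by do 4?[apply: filterI => //]; exact: limP.
  exists x; split=> //.
  - by move=> i ib; exact: (x2 (Ordinal (ib : i < b.+1))).
  - move=> i j ib jb.
    exact: (x3 (Ordinal (ib : i < b.+1), Ordinal (jb : j < b.+1))).
  - move=> i j k ib jb kb.
    exact: (x4 (Ordinal (ib : i < b.+1), Ordinal (jb : j < b.+1), Ordinal (kb : k < b.+1))).
pose h n := iter n.+1 g 0.
have hS n : h n.+1 = g (h n) by [].
have hi : {homo h : i j / i < j}.
  by apply: homo_ltn => [? ? ?|i]; [exact: ltn_trans|rewrite hS; have [] := gP (h i)].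
have hl i j : i <= j -> h i <= h j.
  by rewrite leq_eqVlt => /orP[/eqP->//|/hi/ltnW].
exists h; split=> //; exists c => i [//|j] [//|k] [//|l]; rewrite !ltnS => ij jk kl.
have ik := leq_ltn_trans ij jk.
have hij := hl _ _ ij; have hik := hl _ _ (ltnW ik); have hjk := hl _ _ jk.
have hkl := hl _ _ kl; have hil := leq_trans hik (hl _ _ (ltnW kl)).
have hjl := leq_trans hjk (hl _ _ (ltnW kl)).
have [_ _ _ _ /(_ _ _ _ hil hjl hkl) ->] := gP (h l).
have [_ _ _ /(_ _ _ hik hjk) -> _] := gP (h k).
have [_ _ /(_ _ hij) -> _ _] := gP (h j).
by case: i {ij ik hij hik hil} => [|i]; [have [_ ->] := gP 0|have [_ ->] := gP (h i)].
Qed.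

Lemma increasing_cover (w : 'I_4 -> nat) :
  exists (i : 'I_4 -> nat) (p : 'I_4 -> 'I_4),
    (forall x y : 'I_4, x < y -> i x < i y) /\ forall x, w x = i (p x).
Proof.
pose b := (\max_x w x).+1.
have wb x : w x < b by rewrite ltnS leq_bigmax.
(* The values of [w] in increasing order, padded with four numbers above them in case of
   repetitions. *)
pose Q := [pred x | (x \in codom w) || (b <= x)].
pose s1 := [seq x <- iota 0 b | Q x]; pose s2 := [seq x <- iota b 4 | Q x].
have s2E : s2 = iota b 4.
  by apply/all_filterP/allP => x; rewrite mem_iota inE => /andP[->]; rewrite orbT.
have s1size : size s1 <= 4.
  have <- : size (codom w) = 4 by rewrite size_codom card_ord.
  apply: uniq_leq_size => [|x]; first by rewrite filter_uniq ?iota_uniq.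
  rewrite mem_filter mem_iota add0n /= => /andP[/orP[//|bx] xb].
  by move: xb; rewrite ltnNge bx.
have s12 : sorted ltn (s1 ++ s2).
  rewrite -filter_cat -[X in iota X 4]add0n -iotaD.
  exact/(sorted_filter ltn_trans)/iota_ltn_sorted.
have w1 x : w x \in s1.
  by rewrite mem_filter inE codom_f mem_iota add0n wb.
have idx x : index (w x) s1 < 4 by apply: leq_trans s1size; rewrite index_mem.
exists (fun x => nth 0 (s1 ++ s2) x), (fun x => Ordinal (idx x)); split=> [x y xy|x].
  apply: (sorted_ltn_nth ltn_trans 0 s12) => //; rewrite inE size_cat s2E size_iota.
    exact: ltn_addl.
  exact: ltn_addl.
by rewrite /= nth_cat index_mem w1 nth_index.
Qed.

(** The colour of an increasing quadruple records the truth of [R] at every arrangement of its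
    entries, repetitions included. Hence along [h] the truth of [R] depends only on the order
    pattern, which [g] preserves. *)
Lemma ramsey_homogeneous (R : nat -> nat -> nat -> nat -> Prop) :
  exists h : nat -> nat, {homo h : i j / i < j} /\
    forall (g : nat -> nat) s u v t, {homo g : i j / i < j} ->
      R (h s) (h u) (h v) (h t) <-> R (h (g s)) (h (g u)) (h (g v)) (h (g t)).
Proof.
pose o k : 'I_4 := inord k.
pose Rp (x : 'I_4 -> nat) (p : {ffun 'I_4 -> 'I_4}) :=
  `[< R (x (p (o 0))) (x (p (o 1))) (x (p (o 2))) (x (p (o 3))) >].
pose F i j k l := [ffun p : {ffun 'I_4 -> 'I_4} => Rp (nth 0 [:: i; j; k; l]) p].
have [h [hi [c hc]]] := ramsey4 F.
exists h; split=> // g s u v t gi.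
pose w (x : 'I_4) := nth 0 [:: s; u; v; t] x.
have [i [p [ii wi]]] := increasing_cover w.
have col (f : nat -> nat) : {homo f : i j / i < j} ->
    R (h (f s)) (h (f u)) (h (f v)) (h (f t)) <-> c (finfun p).
  move=> fi.
  have fii x y : x < y < 4 -> f (i (o x)) < f (i (o y)).
    by move=> /andP[xy y4]; apply/fi/ii; rewrite !inordK // (ltn_trans xy).
  rewrite -(hc _ _ _ _ (fii 0 1 isT) (fii 1 2 isT) (fii 2 3 isT)) ffunE /Rp.
  rewrite asboolE !ffunE.
  have E x : nth 0 [:: h (f (i (o 0))); h (f (i (o 1))); h (f (i (o 2))); h (f (i (o 3)))] (p x)
      = h (f (w x)).
    rewrite wi; have : p x = o (p x) by rewrite /o inord_val.
    by case: (p x) => -[|[|[|[|]]]] //= ? ->.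
  by rewrite !E /w !inordK.
by have colid := col id; rewrite colid // (col g).
Qed.

(* [Th s u v t] stands for the truth value of [phi /\ psi] at [(b_s, c_{u,v}, a_t)].
   By homogeneity it does not change when [s] (resp. [t]) moves to the next
   position, unless [s = u] (resp. [t = v]). *)
Lemma grid_code (Th : nat -> nat -> nat -> nat -> Prop) k (E : nat -> nat -> Prop) :
  (forall s t, Th s s t t) ->
  (forall s s' t, s < s' -> ~ Th s' s t t) ->
  (forall s u v (tau : 'I_k -> nat), injective tau -> ~ forall i, Th s u v (tau i)) ->
  (forall (g : nat -> nat) s u v t, {homo g : i j / i < j} ->
    Th s u v t <-> Th (g s) (g u) (g v) (g t)) ->
  forall i j, E i j <-> exists u v, [/\ E u v,
    Th (4 * i) (4 * u) (4 * v + 2) (4 * j + 2),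
    ~ Th (4 * i + 1) (4 * u) (4 * v + 2) (4 * j + 2) &
    ~ Th (4 * i) (4 * u) (4 * v + 2) (4 * j + 3)].
Proof.
move=> Tdiag Tlt Tinj Thom i j; split=> [Eij|[u [v [Euv T1 T2 T3]]]].
  exists i, j; split=> //; first by apply: Tlt; rewrite addn1.
  (* Only the place [4 * j + 3] moves with [m], and the gap of [k] above it keeps [g m] increasing.
     Homogeneity then gives [k] distinct last arguments, against the finiteness hypothesis. *)
  move=> T; pose g m x := if x <= 4 * j + 2 then x
    else if x == 4 * j + 3 then x + m else x + k.
  have gi m : m <= k -> {homo g m : x y / x < y}.
    move=> mk x y xy; rewrite /g; case: (leqP x); case: (leqP y) => //.
    - by case: eqP => *; lia.
    - by lia.
    - by case: eqP => ?; case: eqP => ?; lia.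
  apply: (Tinj (g 0 (4 * i)) (g 0 (4 * i)) (4 * j + 2) (fun m => 4 * j + 3 + m)).
    by move=> x y /addnI/val_inj.
  move=> m; have := (Thom (g m) _ _ _ _ (gi m (ltnW (ltn_ord m)))).1 T.
  have -> : g m (4 * i) = g 0 (4 * i).
    by rewrite /g; case: ifP => // ?; case: eqP => //; lia.
  have -> : g m (4 * j + 2) = 4 * j + 2 by rewrite /g leqnn.
  suff -> : g m (4 * j + 3) = 4 * j + 3 + m by [].
  by rewrite /g eqxx; case: ifP => //; lia.
(* The two maps differ only at [z]. Even numbers serve the first index and odd ones the second, so
   moving [z] changes only one argument unless [i = u], respectively [j = v]. *)
pose g1 x := 2 * x; pose g2 z x := 2 * x + (x == z).
have g1i : {homo g1 : x y / x < y} by move=> x y; rewrite /g1; lia.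
have g2i z : {homo g2 z : x y / x < y}.
  by move=> x y xy; rewrite /g2; case: eqP => ?; case: eqP => ? /=; lia.
have [iu|iu] := eqVneq i u; last first.
  case: T2; move: T1.
  have := Thom g1 (2 * i) (2 * u) (2 * v + 1) (2 * j + 1) g1i.
  have := Thom (g2 (2 * i)) (2 * i) (2 * u) (2 * v + 1) (2 * j + 1) (g2i _).
  have -> : g2 (2 * i) (2 * i) = 4 * i + 1 by rewrite /g2 eqxx /=; lia.
  have -> : g2 (2 * i) (2 * u) = 4 * u by rewrite /g2; case: eqP => [|_ /=]; lia.
  have -> : g2 (2 * i) (2 * v + 1) = 4 * v + 2 by rewrite /g2; case: eqP => [|_ /=]; lia.
  have -> : g2 (2 * i) (2 * j + 1) = 4 * j + 2 by rewrite /g2; case: eqP => [|_ /=]; lia.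
  have -> : g1 (2 * i) = 4 * i by rewrite /g1; lia.
  have -> : g1 (2 * u) = 4 * u by rewrite /g1; lia.
  have -> : g1 (2 * v + 1) = 4 * v + 2 by rewrite /g1; lia.
  have -> : g1 (2 * j + 1) = 4 * j + 2 by rewrite /g1; lia.
  by move=> -> ->.
have [jv|jv] := eqVneq j v; first by rewrite iu jv.
case: T3; move: T1.
have := Thom g1 (2 * i) (2 * u) (2 * v + 1) (2 * j + 1) g1i.
have := Thom (g2 (2 * j + 1)) (2 * i) (2 * u) (2 * v + 1) (2 * j + 1) (g2i _).
have -> : g2 (2 * j + 1) (2 * i) = 4 * i by rewrite /g2; case: eqP => [|_ /=]; lia.
have -> : g2 (2 * j + 1) (2 * u) = 4 * u by rewrite /g2; case: eqP => [|_ /=]; lia.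
have -> : g2 (2 * j + 1) (2 * v + 1) = 4 * v + 2 by rewrite /g2; case: eqP => [|_ /=]; lia.
have -> : g2 (2 * j + 1) (2 * j + 1) = 4 * j + 3 by rewrite /g2 eqxx /=; lia.
have -> : g1 (2 * i) = 4 * i by rewrite /g1; lia.
have -> : g1 (2 * u) = 4 * u by rewrite /g1; lia.
have -> : g1 (2 * v + 1) = 4 * v + 2 by rewrite /g1; lia.
have -> : g1 (2 * j + 1) = 4 * j + 2 by rewrite /g1; lia.
by move=> -> ->.
Qed.

(** * The dichotomy *)

Section Dichotomy.
Variables (L : language) (M : structure L) (K : Type).
Hypothesis Kinf : infinite_set [set: K].
Hypothesis small_cnt : forall A : set M, countable A -> small K A.
Hypothesis Msat : saturated M K.
Hypothesis Mhom : strongly_homogeneous M K.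
Hypothesis MNIP1 : forall P : set M, NIP (Th (unary_expansion (fun _ : unit => P))).

(** NIP for [M] itself comes from its expansion by an empty predicate. *)
Lemma definable_not_shatters V W (X : (V + W -> M) -> Prop) : definable setT X -> ~ shatters X.
Proof.
move=> DX; pose M' := unary_expansion (fun _ : unit => @set0 M).
have DX' : @definable _ M' setT _ X by exact: definable_lift DX.
exact (@NIP_not_shatters _ M' V W X (MNIP1 (P := set0)) DX').
Qed.

Lemma indiscernible_fiber B n l (b : 'I_n -> M) (a : nat * 'I_l -> M) t :
  indiscernible (B `|` range b) a ->
  same_type B (join b (fun j => a (0, j))) (join b (fun j => a (t, j))).
Proof.
move=> aB X BX Xa; pose Z (v : nat * 'I_l -> M) := X (join b (fun j => v (0, j))).
have BZ : definable (B `|` range b) Z.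
  pose s (x : 'I_n + 'I_l) : nat * 'I_l + M :=
    match x with inl i => inr (b i) | inr j => inl (0, j) end.
  apply: definable_ext (definable_subst (s := s) _ (definable_sub _ BX))
    => [v|[i|//] y [<-]|x]; [|by right; exists i|by left].
  suff -> : inst v \o s = join b (fun j => v (0, j)) by [].
  by apply/funext => -[].
have tt : {homo addn t : x y / x < y} by move=> x y; rewrite ltn_add2l.
by have := (aB Z BZ _ tt).1 Xa; rewrite /Z /reindex /= addn0.
Qed.

Lemma no_forking_grid B n l k (b : 'I_n -> M) (c : M) (a : nat * 'I_l -> M)
    (phi : ('I_(n + 1) + 'I_l -> M) -> Prop) (psi : ('I_n + ('I_1 + 'I_l) -> M) -> Prop) :
  small K B -> definable B phi -> definable B psi -> indiscernible B a ->
  nonforking B b (B `|` range (fun j => a (0, j))) ->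
  phi (join (tcat b (tsingle c)) (fun j => a (0, j))) ->
  psi (join b (join (tsingle c) (fun j => a (0, j)))) ->
  inconsistent k phi (fun i j => a (i, j)) ->
  ~ forking B (fun x => psi (join x (join (tsingle c) (fun j => a (0, j))))).
Proof.
move=> Bsm Bphi Bpsi aB bB phic psic phik fpsi.
pose al t j := a (t, j).
pose V3 := ('I_n + ('I_1 + 'I_l))%type.
pose re (x : 'I_(n + 1) + 'I_l) : V3 := match x with
  | inl x => match fintype.split x with inl i => inl i | inr i => inr (inl i) end
  | inr j => inr (inr j) end.
pose th (w : V3 -> M) := phi (w \o re) /\ psi w.
have Bth : definable B th by apply: definable_and => //; exact: definable_comp.
have thE x z y : th (join x (join z y)) <->
    phi (join (tcat x z) y) /\ psi (join x (join z y)).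
  rewrite /th; suff -> : join x (join z y) \o re = join (tcat x z) y by [].
  by apply/funext => -[u|u] //=; rewrite /tcat; case: fintype.split.
pose D0 := B `|` range a.
have D0sm : small K D0 by exact: small_range.
have BD0 : B `|` range (al 0) `<=` D0.
  by move=> x [Bx|[j _ <-]]; [left|right; exists (0, j)].
(* One step of the construction: a copy of [b] not forking with [D], and its whole row of copies of
   [c]. The row exists because [a] stays indiscernible over the new [b], which therefore relates to
   each [a_t] as [b] does to [a_0]. *)
have /choice[F FP] : forall D : set M, exists bc : ('I_n -> M) * (nat -> M),
    small K D -> D0 `<=` D -> nonforking B bc.1 D /\ forall t,
    same_type B (join b (join (tsingle c) (al 0))) (join bc.1 (join (tsingle (bc.2 t)) (al t))).
  move=> D; have [[Dsm D0D]|nD] := pselect (small K D /\ D0 `<=` D); last first.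
    by exists (b, fun=> c) => Dsm D0D; case: nD.
  have [b' bb' b'D] := nonforking_extend Msat Dsm (subset_trans BD0 D0D) bB.
  have aBb' : indiscernible (B `|` range b') a.
    apply: (indiscernible_nonforking definable_not_shatters aB b'D) => [x Bx|p];
      apply: D0D; first by left.
    by right; exists p.
  have baE t : same_type B (join b (al 0)) (join b' (al t)).
    exact: (same_type_trans (same_type_join bb') (indiscernible_fiber t aBb')).
  have /choice[c' c'P] : forall t, exists c', same_type B (join b (join (tsingle c) (al 0)))
      (join b' (join (tsingle c') (al t))).
    move=> t; have [w ww] := same_type_extend Mhom (tsingle c)
      (small_range Kinf small_cnt (join b (al 0)) Bsm) (baE t).
    exists (w ord0).
    pose s (x : V3) : ('I_n + 'I_l) + 'I_1 := match x with
      | inl i => inl (inl i) | inr (inl i) => inr i | inr (inr j) => inl (inr j) end.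
    have := same_type_comp (s := s) ww.
    have -> : join (join b (al 0)) (tsingle c) \o s = join b (join (tsingle c) (al 0)).
      by apply/funext => -[|[]].
    suff -> : join (join b' (al t)) w \o s = join b' (join (tsingle (w ord0)) (al t)) by [].
    by apply/funext => -[|[i|]] //=; rewrite ord1.
  by exists (b', c').
(* Stage [s] contains [B], the sequence [a] and all rows of copies of [c] built before. *)
pose fix D s := if s is s'.+1 then D s' `|` range (F (D s')).2 else D0.
have Dsm s : small K (D s) by elim: s => //= s IH; exact: small_range.
have DD s s' : s <= s' -> D s `<=` D s'.
  elim: s' => [|s' IH]; first by rewrite leqn0 => /eqP ->.
  by rewrite leq_eqVlt => /orP[/eqP ->//|/IH ss x /ss]; left.
pose bb s := (F (D s)).1; pose cc s t := (F (D s)).2 t.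
have bbD s : nonforking B (bb s) (D s) by have [] := FP (D s) (Dsm s) (DD 0 s isT).
have bcE s t : same_type B (join b (join (tsingle c) (al 0)))
    (join (bb s) (join (tsingle (cc s t)) (al t))).
  by have [_ H] := FP (D s) (Dsm s) (DD 0 s isT); exact: H.
have ccD s s' t : s < s' -> D s' (cc s t) by move=> /DD; apply; right; exists t.
have alD s t j : D s (al t j) by apply: (DD 0 s isT); right; exists (t, j).
pose Th s u v t := th (join (bb s) (join (tsingle (cc u v)) (al t))).
have Tdiag s t : Th s s t t by apply: bcE => //; apply/thE.
(* The parameters of [psi] lie in [D s'], and [psi] at them forks by invariance, so it cannot hold
   of [bb s']. *)
have Tlt s s' t : s < s' -> ~ Th s' s t t.
  move=> ss [_ Y]; apply: (bbD s' (fun x => psi (join x (join (tsingle (cc s t)) (al t))))) Y _.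
    apply: definable_plug (definable_sub _ Bpsi) => [[i|j]|x Bx] /=; [exact: ccD|exact: alD|].
    by apply: (DD 0 s' isT); left.
  apply: (forking_same_type Kinf small_cnt Mhom Bsm _ Bpsi _ fpsi) => //.
  exact: (same_type_comp (s := inr) (bcE s t)).
have Tinj s u v (tau : 'I_k -> nat) : injective tau -> ~ forall i, Th s u v (tau i).
  move=> taui H; apply: (phik tau taui); exists (tcat (bb s) (tsingle (cc u v))) => i.
  by have /thE[] := H i.
have [h [hi hhom]] := ramsey_homogeneous Th.
have hinj : injective h.
  by move=> x y exy; case: (ltngtP x y) => // /hi; rewrite exy ltnn.
(* Membership in the finite set coded by [j], a relation that cuts out every finite set; numbers
   coding nothing give the empty list. *)
pose E i j := i \in odflt [::] (unpickle j : option (seq nat)).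
have code := @grid_code (fun s u v t => Th (h s) (h u) (h v) (h t)) k E
  (fun s t => Tdiag (h s) (h t)) (fun s s' t ss => @Tlt (h s) (h s') (h t) (hi _ _ ss))
  (fun s u v tau taui => @Tinj (h s) (h u) (h v) (h \o tau)
     (inj_comp hinj taui)) hhom.
pose P : set M := [set m | exists i j, E i j /\ m = cc (h (4 * i)) (h (4 * j + 2))].
pose V2 := ('I_n + 'I_n)%type; pose W2 := ('I_l + 'I_l)%type.
pose r1 (x : V3) : 'I_1 + (V2 + W2) := match x with
  | inl i => inr (inl (inl i)) | inr (inl z) => inl z | inr (inr j) => inr (inr (inl j)) end.
pose r2 (x : V3) : 'I_1 + (V2 + W2) := match x with
  | inl i => inr (inl (inr i)) | inr (inl z) => inl z | inr (inr j) => inr (inr (inl j)) end.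
pose r3 (x : V3) : 'I_1 + (V2 + W2) := match x with
  | inl i => inr (inl (inl i)) | inr (inl z) => inl z | inr (inr j) => inr (inr (inr j)) end.
(* The bound variable is the marked grid point. [V2] holds the copies of [b] at [4 * i] and
   [4 * i + 1], [W2] the terms of [a] at [4 * j + 2] and [4 * j + 3], so [r1], [r2], [r3] give the
   three conditions of [grid_code]. *)
pose X0 (w : 'I_1 + (V2 + W2) -> M) :=
  P (w (inl ord0)) /\ (th (w \o r1) /\ (~ th (w \o r2) /\ ~ th (w \o r3))).
pose M' := unary_expansion (fun _ : unit => P).
have DX0 : @definable _ M' setT _ X0.
  have Bth' r : @definable _ M' setT _ (fun w : 'I_1 + (V2 + W2) -> M => th (w \o r)).
    by apply: definable_lift; apply: definable_comp; exact: definable_sub Bth.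
  apply: definable_and; first exact: (@definable_unary L unit M (fun=> P) setT _ tt (inl ord0)).
  apply: definable_and; first exact: Bth'.
  by apply: definable_and; apply: definable_neg; exact: Bth'.
apply: (@NIP_not_shatters _ M' V2 W2 _ (MNIP1 (P := P)) (definable_ex DX0)) => N.
pose codeS (S : {set 'I_N}) := pickle [seq val i | i <- enum S].
exists (fun i => join (bb (h (4 * i))) (bb (h (4 * i + 1)))).
exists (fun S => join (al (h (4 * codeS S + 2))) (al (h (4 * codeS S + 3)))).
move=> i S; have -> : i \in S <-> E i (codeS S).
  rewrite /E /codeS pickleK /=; split=> [iS|/mapP[j jS /val_inj ->]].
    by apply: map_f; rewrite mem_enum.
  by rewrite mem_enum in jS.
rewrite code.
set w0 := (fun x : V2 + W2 => _).
have E1 u : join u w0 \o r1 =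
    join (bb (h (4 * i))) (join (tsingle (u ord0)) (al (h (4 * codeS S + 2)))).
  by apply/funext => -[|[z|]] //=; rewrite ord1.
have E2 u : join u w0 \o r2 =
    join (bb (h (4 * i + 1))) (join (tsingle (u ord0)) (al (h (4 * codeS S + 2)))).
  by apply/funext => -[|[z|]] //=; rewrite ord1.
have E3 u : join u w0 \o r3 =
    join (bb (h (4 * i))) (join (tsingle (u ord0)) (al (h (4 * codeS S + 3)))).
  by apply/funext => -[|[z|]] //=; rewrite ord1.
split=> [[u [[i' [j' [Eij uE]]] [T1 [T2 T3]]]]|[i' [j' [Eij T1 T2 T3]]]].
  exists i', j'; rewrite /= in uE; split=> //; rewrite /Th -uE.
  - by rewrite -E1.
  - by rewrite -E2.
  - by rewrite -E3.
exists (tsingle (cc (h (4 * i')) (h (4 * j' + 2)))).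
by split; [exists i', j'|rewrite E1 E2 E3].
Qed.

(** If both alternatives fail, [b] is first moved off the parameters of the dividing formulas
    covering [Z1]. One of these, true of the moved pair, supplies [phi], and the forking [Z2]
    supplies [psi]. *)
Lemma nonforking_dichotomy A B n (b : 'I_n -> M) (c : M) : small K A -> B `<=` A ->
  nonforking B b A -> nonforking B (tcat b (tsingle c)) A \/ nonforking B b (A `|` [set c]).
Proof.
move=> Asm BA bA; apply: contrapT => /not_orP[].
move=> /existsNP[Z1 /not_implyP[AZ1 /not_implyP[Z1bc /contrapT[N [q [qB Z1q]]]]]].
move=> /existsNP[Z2 /not_implyP[AZ2 /not_implyP[Z2b /contrapT fZ2]]].
have Bsm := small_sub BA Asm.
have [Y2 [AY2 ZY2]] : exists Y : ('I_n + 'I_1 -> M) -> Prop,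
    definable A Y /\ forall v, Z2 v <-> Y (join v (tsingle c)).
  by apply: definable_range; apply: definable_sub AZ2 => x [Ax|->]; [left|right; exists ord0].
have [l [d [psi0 [dA Apsi0 Ypsi0]]]] := definable_params AY2.
pose e (x : {i : 'I_N & 'I_(plen (q i))}) : M := ppar (q (tag x)) (tagged x).
pose D := A `|` range e.
have [|b' bb' b'D] := nonforking_extend Msat (small_range Kinf small_cnt e Asm) _ bA.
  by move=> x; left.
have [w bcw] := same_type_extend Mhom (tsingle c) (small_range Kinf small_cnt b Asm) bb'.
pose c' := w ord0; have wE : w = tsingle c' by apply/funext => i; rewrite ord1.
rewrite {}wE in bcw.
have [i qi] : exists i, psat (q i) (tcat b' (tsingle c')).
  apply: Z1q; have AZ := definable_comp (@fintype.split n 1) AZ1.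
  exact: (bcw _ AZ).
have [k [E [EB Einc]]] := dividesP (qB i).
(* [phi] and [psi] must share one parameter tuple, so [d] is appended and the witnesses [E] are
   extended to conjugates of [a0]. As [phi] ignores the new part, it stays [k]-inconsistent. *)
pose p := plen (q i); pose a0 : 'I_(p + l) -> M := tcat (ppar (q i)) d.
have /choice[d' d'P] : forall t, exists d', same_type B a0 (tcat (E t) d').
  move=> t; have [d' dd'] := same_type_extend Mhom d (small_range Kinf small_cnt _ Bsm) (EB t).
  by exists d'; exact: (same_type_comp (s := @fintype.split p l) dd').
pose phi (v : 'I_(n + 1) + 'I_(p + l) -> M) :=
  sat (pform (q i)) (tcat (v \o inl) (v \o (inr \o lshift l))).
have Bphi : definable B phi.
  pose s (x : 'I_(n + 1) + 'I_p) : 'I_(n + 1) + 'I_(p + l) :=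
    match x with inl x => inl x | inr j => inr (lshift l j) end.
  exact: (definable_comp s (definable_sat_tcat B (pform (q i)))).
have phiE x (y : 'I_p -> M) (z : 'I_l -> M) :
    phi (join x (tcat y z)) <-> sat (pform (q i)) (tcat x y).
  rewrite /phi; suff -> : join x (tcat y z) \o (inr \o lshift l) = y by [].
  by apply/funext => j /=; rewrite tcatl.
have phik : inconsistent k phi (fun t => tcat (E t) (d' t)).
  move=> s sinj [x xP]; apply: (Einc s sinj); exists x => j.
  by have /phiE := xP j.
have [a [aB a0E ainc]] := divides_indiscernible Kinf small_cnt Msat Mhom Bsm Bphi d'P phik.
have {}a0E : (fun j => a (0, j)) = a0 by apply/funext.
pose re (x : 'I_n + 'I_1 + 'I_l) : 'I_n + ('I_1 + 'I_(p + l)) := match x with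
  | inl (inl x) => inl x | inl (inr z) => inr (inl z)
  | inr j => inr (inr (rshift p j)) end.
pose psi (v : 'I_n + ('I_1 + 'I_(p + l)) -> M) := psi0 (v \o re).
have Bpsi : definable B psi by apply: definable_comp; apply: definable_sub Apsi0.
have psiE x z : psi (join x (join z a0)) <-> Y2 (join x z).
  rewrite Ypsi0 /psi.
  suff -> : join x (join z a0) \o re = join (join x z) d by [].
  by apply/funext => -[[]|j] //=; rewrite /a0 tcatr.
apply: (no_forking_grid (k := k) (c := c') Bsm Bphi Bpsi aB); rewrite ?a0E //.
- apply: nonforking_sub b'D => x [/BA|[j _ <-]]; first by left.
  rewrite /a0 /tcat; case: fintype.split => u; last by left.
  by right; exists (existT _ i u).
- exact/phiE.
- by apply/psiE; apply: (bcw Y2 AY2); exact/ZY2.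
- apply: (@forking_sub _ _ B _ _ (fun x => Y2 (join x (tsingle c')))) => [x /psiE//|].
  apply: (forking_same_type Kinf small_cnt Mhom Asm BA AY2 _ (a := tsingle c)).
    exact: (same_type_comp (s := inr) bcw).
  by apply: forking_sub fZ2 => x /ZY2.
Qed.

Lemma nonforking_coordinates A B n (a : 'I_n -> M) : small K A -> B `<=` A ->
  (forall i, nonforking B (tsingle (a i)) A) -> nonforking B a A.
Proof.
move=> Asm BA; elim: n a => [|n IH] a aA; first by apply: nonforking_in_base => -[].
pose b := a \o lift ord0; pose c := a ord0.
have bA : nonforking B b A by apply: IH => i; exact: aA.
have bcA : nonforking B (tcat b (tsingle c)) A.
  have [//|bAc] := nonforking_dichotomy c Asm BA bA.
  apply: (nonforking_tcat Kinf small_cnt Msat Mhom definable_not_shatters Asm BA (aA ord0)).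
  by apply: nonforking_sub bAc => x [Ax|[i _ <-]]; [left|right].
(* The coordinate split off first stands last in [tcat]; [s] restores the order. *)
pose s (i : 'I_n.+1) : 'I_(n + 1) :=
  if unlift ord0 i is Some j then lshift 1 j else rshift n ord0.
suff -> : a = tcat b (tsingle c) \o s by exact: nonforking_comp.
by apply/funext => i; rewrite /s /=; case: unliftP => [j|] ->; rewrite ?tcatl ?tcatr.
Qed.

End Dichotomy.

Theorem theorem1p2 (L : language) (T : theory L)
    (hT : complete_theory T) (hNIP : monadically_NIP T)
    (M : structure L) (K : Type) (hM : monster T M K)
    (B C : set M) (hB : small K B) (hC : small K C)
    (n : nat) (a : 'I_n -> M) (c : M) :
  [/\ ~ forks B (tp a (B `|` C)) <->
        (forall i : 'I_n, ~ forks B (tp (tsingle (a i)) (B `|` C))),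
      ~ forks B (tp a (B `|` C)) ->
        ~ forks B (tp (tcat a (tsingle c)) (B `|` C)) \/
        ~ forks B (tp a (B `|` C `|` [set c]))
    & forall (B0 : set M), small K B0 -> forall a0 b0 c0 : M,
        forks B0 (tp (tsingle a0) (B0 `|` [set b0])) ->
        forks B0 (tp (tsingle b0) (B0 `|` [set c0])) ->
        forks B0 (tp (tsingle a0) (B0 `|` [set c0]))].
Proof.
have [MT LK Msat Mhom] := hM.
have Kinf := small_infinite LK.
have small_cnt (A : set M) : countable A -> small K A := small_countable LK.
have MNIP1 (P : set M) : NIP (Th (unary_expansion (fun _ : unit => P))) := hNIP M MT unit (fun=> P).
have smU (A : set M) x : small K A -> small K (A `|` [set x]).
  by move=> Asm; apply: small_setU => //; apply: small_cnt; exact: countable1.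
have nfP (E A : set M) m (u : 'I_m -> M) : small K A -> ~ forks E (tp u A) <-> nonforking E u A.
  exact: not_forksP.
have dich (A E : set M) m (u : 'I_m -> M) x : small K A -> E `<=` A ->
    ~ forks E (tp u A) -> ~ forks E (tp (tcat u (tsingle x)) A) \/
      ~ forks E (tp u (A `|` [set x])).
  move=> Asm EA; rewrite !nfP //; last exact: smU.
  exact: (nonforking_dichotomy Kinf small_cnt Msat Mhom MNIP1).
have BCsm : small K (B `|` C) by exact: small_setU.
split.
- rewrite nfP //; split=> [aBC i|aBC]; first exact/nfP/(nonforking_comp (s := fun=> i) aBC).
  apply: (nonforking_coordinates Kinf small_cnt Msat Mhom MNIP1) => // i.
  exact/nfP.
- by apply: dich => // x; left.
- move=> B0 B0sm a0 b0 c0 ab bc; apply: contrapT => nac.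
  have B0c := smU _ c0 B0sm.
  (* The first alternative contradicts [bc] on passing to the second coordinate, the second
     contradicts [ab] on dropping [c0] from the parameters. *)
  have [|nabc|nabc] := dich _ B0 1 (tsingle a0) b0 B0c _ nac; first by move=> x; left.
    move: bc; apply/(nfP _ _ _ _ B0c).
    have -> : tsingle b0 = tcat (tsingle a0) (tsingle b0) \o @rshift 1 1.
      by apply/funext => i /=; rewrite tcatr.
    by apply: nonforking_comp; exact/nfP.
  move: ab; apply/(nfP _ _ _ _ (smU _ b0 B0sm)).
  move: nabc; rewrite (nfP _ _ _ _ (smU _ b0 B0c)).
  by apply: nonforking_sub => x [Bx|bx]; [left; left|right].
Qed.
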